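(* Let $(M,\phi,\xi,\eta,g)$ be a $(2n+1)$-dimensional Sasakian manifold that satisfies $R(\xi,X)\cdot S=0$ for all $X\in\chi(M)$ and admits a $*$-Conformal $\eta$-Ricci soliton with data $\lambda,\mu,p$. Then $\mu=1$ and $\lambda=\frac12\left(p+\frac{2}{2n+1}\right)-1$.
   Context: Conventions. $\chi(M)$ is the space of smooth vector fields on $M$; $\nabla$ is the Levi-Civita connection of $g$; $R(X,Y)Z=\nabla_X\nabla_YZ-\nabla_Y\nabla_XZ-\nabla_{[X,Y]}Z$; $S(Y,Z)=\mathrm{trace}\{X\mapsto R(X,Y)Z\}$ is the Ricci tensor. Sasakian manifold. An almost contact metric structure on a connected $(2n+1)$-dimensional manifold $M$ ($n\ge 1$) consists of a $(1,1)$-tensor field $\phi$, a vector field $\xi$, a 1-form $\eta$ and a Riemannian metric $g$ with $\phi^2X=-X+\eta(X)\xi$, $\eta(\xi)=1$, $\eta\circ\phi=0$, $\phi\xi=0$, $g(\phi X,\phi Y)=g(X,Y)-\eta(X)\eta(Y)$, $g(X,\phi Y)=-g(\phi X,Y)$, $g(X,\xi)=\eta(X)$. It is a contact metric structure if $d\eta(X,Y)=g(X,\phi Y)$, and it is normal if $2d\eta(X,Y)\xi+[\phi,\phi](X,Y)=0$, where $[\phi,\phi](X,Y)=\phi^2[X,Y]+[\phi X,\phi Y]-\phi[\phi X,Y]-\phi[X,\phi Y]$ and $d\eta(X,Y)=\frac12\big(X\eta(Y)-Y\eta(X)-\eta([X,Y])\big)$. A Sasakian manifold is a normal contact metric manifold;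 with these conventions $\nabla_X\xi=-\phi X$. Soliton. The $*$-Ricci tensor is $S^*(X,Y)=\frac12\,\mathrm{trace}\{\phi\circ R(X,\phi Y)\}$. $M$ admits a $*$-Conformal $\eta$-Ricci soliton (with data $\lambda,\mu,p$) if $\mathcal{L}_\xi g+2S^*+\left[2\lambda-\left(p+\frac{2}{2n+1}\right)\right]g+2\mu\,\eta\otimes\eta=0$, where $\mathcal{L}_\xi$ is the Lie derivative along $\xi$, $\lambda,\mu$ are real constants and $p$ is a (smooth) scalar field. The condition $R(\xi,X)\cdot S=0$ means $S(R(\xi,X)Y,Z)+S(Y,R(\xi,X)Z)=0$ for all $X,Y,Z\in\chi(M)$. *)

(* Defs.v *)
From HB Require Import structures.
From mathcomp Require Import all_boot all_order all_algebra.
From mathcomp Require Import all_classical all_reals all_analysis.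
Set Implicit Arguments.
Unset Strict Implicit.
Unset Printing Implicit Defensive.
Import Order.TTheory GRing.Theory Num.Theory numFieldNormedType.Exports.
Local Open Scope classical_set_scope.
Local Open Scope ring_scope.

(* C^k on the open set U: a C^(k+1) map is a map that is Frechet differentiable
   on U and such that x |-> df_x(v) is C^k for every fixed direction v (in
   finite dimension: all the partial derivatives are C^k). *)
Fixpoint Ck_on (R : realType) (V W : normedModType R) (k : nat) (U : set V)
    (f : V -> W) : Prop :=
  match k with
  | 0 => forall x, U x -> {for x, continuous f}
  | k'.+1 => (forall x, U x -> differentiable f x) /\
             forall v, Ck_on k' U (fun x => 'd f x v)
  end.

Definition smooth_on (R : realType) (V W : normedModType R) (U : set V)
    (f : V -> W) : Prop := forall k, Ck_on k U f.

(* The values of cmap outside cdom, and of cinv outside the image of cdom, are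
   irrelevant. *)
Record chart (R : realType) (m : nat) (T : Type) := Chart {
  cdom : set T;
  cmap :> T -> 'rV[R]_m;
  cinv : 'rV[R]_m -> T }.

Definition cimg (R : realType) (m : nat) (T : Type) (c : chart R m T) :
  set 'rV[R]_m := c @` cdom c.

Definition is_chart (R : realType) (m : nat) (T : topologicalType)
    (c : chart R m T) : Prop :=
  [/\ open (cdom c), open (cimg c),
      forall x, cdom c x -> cinv c (c x) = x,
      forall x, cdom c x -> {for x, continuous (cmap c)} &
      forall z, cimg c z -> {for z, continuous (cinv c)}].

Record smooth_manifold (R : realType) (m : nat) := SmoothManifold {
  carrier :> topologicalType;
  atlas : set (chart R m carrier);
  manifold_nonempty : [set: carrier] !=set0;
  manifold_hausdorff : hausdorff_space carrier;
  manifold_second_countable : @second_countable carrier;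
  atlas_chart : forall c, atlas c -> is_chart c;
  atlas_cover : forall x, exists c, atlas c /\ cdom c x;
  atlas_compat : forall c c', atlas c -> atlas c' ->
    smooth_on (c @` (cdom c `&` cdom c')) (c' \o cinv c) }.

Section Fields.
Variables (R : realType) (m : nat) (M : smooth_manifold R m).
Implicit Types (f : M -> R) (x : M).

(* A chart of the atlas around x, chosen once and for all. *)
Definition chart_at x : chart R m M := projT1 (cid (atlas_cover x)).

(* The tangent space at x is R^m: a vector is given by its components in the
   coordinates of chart_at x. A vector field is accordingly a function
   M -> 'rV_m; note that chart_at x varies, possibly discontinuously, with x,
   so that such a function is read in a chart through coord below. *)
Definition tangent (_ : M) := 'rV[R]_m.
Definition vfield := M -> 'rV[R]_m.

(* Components, in the coordinates of an arbitrary chart c around x, of a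
   tangent vector v at x. *)
Definition coord (c : chart R m M) x (v : tangent x) : 'rV[R]_m :=
  'd (c \o cinv (chart_at x)) (chart_at x x) v.

(* The R^m-valued function on the image of c that represents X in the chart. *)
Definition vf_rep (c : chart R m M) (X : vfield) (z : 'rV[R]_m) : 'rV[R]_m :=
  coord c (X (cinv c z) : tangent (cinv c z)).

Definition smooth_fun f : Prop :=
  forall c : chart R m M, atlas c -> smooth_on (cimg c) (f \o cinv c).

Definition smooth_vf (X : vfield) : Prop :=
  forall c : chart R m M, atlas c -> smooth_on (cimg c) (vf_rep c X).

(* The derivative X(f) of a function along a vector field. *)
Definition vf_act (X : vfield) f : M -> R :=
  fun x => 'd (f \o cinv (chart_at x)) (chart_at x x) (X x).

(* [X, Y]^i = X^j d_j Y^i - Y^j d_j X^i, at each point x in the coordinates of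
   chart_at x. *)
Definition lie_bracket (X Y : vfield) : vfield :=
  fun x => let c := chart_at x in
    'd (vf_rep c Y) (c x) (X x) - 'd (vf_rep c X) (c x) (Y x).

(* Trace at x of a C^oo(M)-linear endomorphism F of the module of smooth vector
   fields, i.e. of the endomorphism X x |-> F X x of the tangent space at x;
   A is the matrix of the latter (acting on row vectors). *)
Definition trace_field (F : vfield -> vfield) : M -> R :=
  fun x => \tr (xget (0 : 'M[R]_m)
    [set A | forall X, smooth_vf X -> F X x = X x *m A]).

Definition tensor02 := forall x, tangent x -> tangent x -> R.
Definition tensor11 := forall x, {linear 'rV[R]_m -> 'rV[R]_m}.
Definition covector_field := forall x, {scalar 'rV[R]_m}.

Definition ap02 (g : tensor02) (X Y : vfield) : M -> R :=
  fun x => g x (X x) (Y x).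
Definition ap11 (phi : tensor11) (X : vfield) : vfield :=
  fun x => phi x (X x).
Definition ap1 (eta : covector_field) (X : vfield) : M -> R :=
  fun x => eta x (X x).

Record riemannian_metric (g : tensor02) : Prop := {
  metric_linear : forall x v, scalar (fun u : 'rV[R]_m => g x u v);
  metric_sym : forall x u v, g x u v = g x v u;
  metric_pos : forall x u, u != 0 -> 0 < g x u u;
  metric_smooth : forall X Y,
    smooth_vf X -> smooth_vf Y -> smooth_fun (ap02 g X Y) }.

(* nabla is unconstrained, and never used, on non-smooth fields. *)
Record levi_civita (g : tensor02) (nabla : vfield -> vfield -> vfield) : Prop := {
  conn_smooth : forall X Y,
    smooth_vf X -> smooth_vf Y -> smooth_vf (nabla X Y);
  conn_addl : forall X X' Y, smooth_vf X -> smooth_vf X' -> smooth_vf Y ->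
    forall x, nabla (fun y => X y + X' y) Y x = nabla X Y x + nabla X' Y x;
  conn_scalel : forall f X Y, smooth_fun f -> smooth_vf X -> smooth_vf Y ->
    forall x, nabla (fun y => f y *: X y) Y x = f x *: nabla X Y x;
  conn_addr : forall X Y Y', smooth_vf X -> smooth_vf Y -> smooth_vf Y' ->
    forall x, nabla X (fun y => Y y + Y' y) x = nabla X Y x + nabla X Y' x;
  conn_leibniz : forall f X Y, smooth_fun f -> smooth_vf X -> smooth_vf Y ->
    forall x, nabla X (fun y => f y *: Y y) x =
              vf_act X f x *: Y x + f x *: nabla X Y x;
  conn_torsion_free : forall X Y, smooth_vf X -> smooth_vf Y ->
    forall x, nabla X Y x - nabla Y X x = lie_bracket X Y x;
  conn_metric : forall X Y Z, smooth_vf X -> smooth_vf Y -> smooth_vf Z ->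
    forall x, vf_act X (ap02 g Y Z) x =
              ap02 g (nabla X Y) Z x + ap02 g Y (nabla X Z) x }.

Definition curvature (nabla : vfield -> vfield -> vfield) (X Y Z : vfield) :
    vfield :=
  fun x => nabla X (nabla Y Z) x - nabla Y (nabla X Z) x
           - nabla (lie_bracket X Y) Z x.

Definition ricci (nabla : vfield -> vfield -> vfield) (Y Z : vfield) : M -> R :=
  trace_field (fun X => curvature nabla X Y Z).

Definition lie_derivative (V : vfield) (g : tensor02) (X Y : vfield) : M -> R :=
  fun x => vf_act V (ap02 g X Y) x
           - ap02 g (lie_bracket V X) Y x - ap02 g X (lie_bracket V Y) x.

Definition ext_d (eta : covector_field) (X Y : vfield) : M -> R :=
  fun x => 2^-1 * (vf_act X (ap1 eta Y) x - vf_act Y (ap1 eta X) x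
                   - ap1 eta (lie_bracket X Y) x).

(* The Nijenhuis torsion [phi, phi]. *)
Definition nijenhuis (phi : tensor11) (X Y : vfield) : vfield :=
  fun x => ap11 phi (ap11 phi (lie_bracket X Y)) x
           + lie_bracket (ap11 phi X) (ap11 phi Y) x
           - ap11 phi (lie_bracket (ap11 phi X) Y) x
           - ap11 phi (lie_bracket X (ap11 phi Y)) x.

Record almost_contact_metric (phi : tensor11) (xi : vfield)
    (eta : covector_field) (g : tensor02) : Prop := {
  acm_metric : riemannian_metric g;
  acm_phi_smooth : forall X, smooth_vf X -> smooth_vf (ap11 phi X);
  acm_xi_smooth : smooth_vf xi;
  acm_eta_smooth : forall X, smooth_vf X -> smooth_fun (ap1 eta X);
  acm_phi2 : forall x (u : tangent x),
    phi x (phi x u) = - u + eta x u *: xi x;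
  acm_eta_xi : forall x, eta x (xi x) = 1;
  acm_eta_phi : forall x (u : tangent x), eta x (phi x u) = 0;
  acm_phi_xi : forall x, phi x (xi x) = 0;
  acm_g_phi : forall x (u v : tangent x),
    g x (phi x u) (phi x v) = g x u v - eta x u * eta x v;
  acm_g_skew : forall x (u v : tangent x), g x u (phi x v) = - g x (phi x u) v;
  acm_g_xi : forall x (u : tangent x), g x u (xi x) = eta x u }.

Record sasakian (phi : tensor11) (xi : vfield) (eta : covector_field)
    (g : tensor02) : Prop := {
  sasakian_acm : almost_contact_metric phi xi eta g;
  sasakian_contact : forall X Y, smooth_vf X -> smooth_vf Y ->
    forall x, ext_d eta X Y x = ap02 g X (ap11 phi Y) x;
  sasakian_normal : forall X Y, smooth_vf X -> smooth_vf Y ->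
    forall x, (2 * ext_d eta X Y x) *: xi x + nijenhuis phi X Y x = 0 }.

Definition star_ricci (nabla : vfield -> vfield -> vfield) (phi : tensor11)
    (X Y : vfield) : M -> R :=
  fun x => 2^-1 *
    trace_field (fun Z => ap11 phi (curvature nabla X (ap11 phi Y) Z)) x.

(* The condition R(xi, X) . S = 0 for all X. *)
Definition ricci_semisymmetric_along (nabla : vfield -> vfield -> vfield)
    (xi : vfield) : Prop :=
  forall X Y Z, smooth_vf X -> smooth_vf Y -> smooth_vf Z -> forall x,
    ricci nabla (curvature nabla xi X Y) Z x +
    ricci nabla Y (curvature nabla xi X Z) x = 0.

(* The dimension is m = 2n + 1, whence the coefficient p + 2 / m. *)
Definition star_conformal_eta_ricci_soliton
    (nabla : vfield -> vfield -> vfield) (phi : tensor11) (xi : vfield)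
    (eta : covector_field) (g : tensor02) (lambda mu : R) (p : M -> R) : Prop :=
  smooth_fun p /\
  forall X Y, smooth_vf X -> smooth_vf Y -> forall x,
    lie_derivative xi g X Y x + 2 * star_ricci nabla phi X Y x
    + (2 * lambda - (p x + 2 / m%:R)) * ap02 g X Y x
    + 2 * mu * (ap1 eta X x * ap1 eta Y x) = 0.

End Fields.

(* Main.v *)
Require Import Defs.
From HB Require Import structures.
From mathcomp Require Import all_boot all_order all_algebra.
From mathcomp Require Import all_classical all_reals all_analysis.
From mathcomp Require Import ring lra.
Set Implicit Arguments.
Unset Strict Implicit.
Unset Printing Implicit Defensive.
Import Order.TTheory GRing.Theory Num.Theory numFieldNormedType.Exports.
Local Open Scope classical_set_scope.
Local Open Scope ring_scope.

(* The tensor identities are pure algebra over the commutative ring C^oo(M) and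
   its module of smooth fields. Normality and d(d eta) = 0 give nabla xi = - phi and
   (nabla_X phi) Y = g(X,Y) xi - eta(Y) X, hence
   R(X,Y) xi = eta(Y) X - eta(X) Y and a formula for [R(X,Y), phi].
   For a horizontal field E (eta(E) = 0), R(xi,E).S = 0 evaluated at (E,xi) reads
   S(E,E) = S(xi,xi) g(E,E) = 2n g(E,E), and the first Bianchi identity turns
   2 S^*(E,E) into S(E,E) + S(phi E, phi E) - (4n-2) g(E,E), so
   S^*(E,E) = g(E,E). As xi is Killing and S^*(xi,xi) = 0, the soliton equation
   at (E,E) and at (xi,xi) is a linear system for lambda and mu.

   To read the traces pointwise one needs global smooth fields with a prescribed
   value at a point, i.e. bump functions, and to have d^2 = 0 and the Jacobi
   identity one needs the symmetry of second derivatives. *)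

(** * Smooth maps between normed spaces *)

(** A tangent vector is stored in the chart chosen at its point, and [nabla] is constrained only on
    global smooth fields. So identities are proved for elements of a module over a ring; points
    enter only when a trace is read or positivity of [g] is used. Since [trace_field] chooses a
    matrix, it needs both existence of that matrix (tensoriality) and uniqueness of its action
    (fields with any prescribed value).

    Sasakian means normal and contact here, so the formula for nabla phi has to be reached: its
    defect is a trilinear form that is skew in the last two arguments, cyclic and compatible with
    phi, and these symmetries force it to vanish.

    Horizontal test fields are taken of the form phi X, because eta(phi X) = 0 holds on all of M and
    not merely at one point.

    The constant 4n-2 is 2(2n+1) - 4: the trace of twice the identity, less four rank-one maps of
    trace g(E,E) each. *)

Section Smooth.
Context {R : realType}.
Implicit Types V W : normedModType R.

(** Readings of one object in two charts agree only near a point; the first-order expansion depends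
    on the germ alone, so the differential passes from one reading to the other. *)
Lemma near_eq_diff V W (f g : V -> W) x :
  {near x, f =1 g} -> differentiable f x ->
  differentiable g x /\ 'd g x = 'd f x :> (V -> W).
Proof.
move=> fg /diff_locallyP[dc df].
have dg : g \o shift x = cst (g x) + 'd f x +o_ 0 id.
  have fgx : f x = g x := nbhs_singleton fg.
  apply/eqaddoP => e e0; move/eqaddoP : df => /(_ _ e0).
  have : \forall h \near (0 : V), f (h + x) = g (h + x).
    by have := fg; rewrite (near_shift 0 x); apply: filterS => h /=; rewrite subr0.
  by apply: filterS2 => h /= fgh; rewrite !fctE /= -fgx -fgh.
have gd : 'd g x = 'd f x :> (V -> W) by apply: diff_unique.
split; last exact: gd.
apply/diff_locallyP; rewrite gd; split; [exact: dc|exact: dg].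
Qed.

Lemma Ck_on_sub V W k (U U' : set V) (f : V -> W) :
  U' `<=` U -> Ck_on k U f -> Ck_on k U' f.
Proof.
elim: k f => [|k IH] f sU /=; first by move=> H x /sU/H.
by case=> df ddf; split=> [x /sU/df//|v]; exact: IH (ddf v).
Qed.

(** Every clause of [Ck_on] is a condition at single points, so it may be checked on sets that vary
    with the point. *)
Lemma Ck_on_cover V W k (U : set V) (f : V -> W) :
  (forall x, U x -> exists2 U', U' x & Ck_on k U' f) -> Ck_on k U f.
Proof.
elim: k f => [|k IH] f /= H; first by move=> x /H[U' U'x]; apply.
split=> [x /H[U' U'x [+ _]]|v]; first exact.
by apply: IH => x /H[U' U'x [_ /(_ v)]]; exists U'.
Qed.

Lemma open_eq_near V W (U : set V) (f g : V -> W) x :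
  open U -> (forall y, U y -> f y = g y) -> U x -> {near x, f =1 g}.
Proof. by move=> oU fg Ux; apply: filterS (open_nbhs_nbhs (conj oU Ux)). Qed.

Lemma Ck_on_eq V W k (U : set V) (f g : V -> W) :
  open U -> (forall x, U x -> f x = g x) -> Ck_on k U f -> Ck_on k U g.
Proof.
move=> oU; elim: k f g => [|k IH] f g fg /=.
  move=> cf x Ux; have nfg := open_eq_near oU fg Ux.
  have := cf x Ux; rewrite /prop_for /continuous_at (fg _ Ux); apply: cvg_trans.
  exact: near_eq_cvg.
case=> df ddf; split=> [x Ux|v].
  by have [] := near_eq_diff (open_eq_near oU fg Ux) (df x Ux).
apply: IH (ddf v) => x Ux.
by have [_ ->] := near_eq_diff (open_eq_near oU fg Ux) (df x Ux).
Qed.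

Lemma Ck_onW V W k (U : set V) (f : V -> W) : Ck_on k.+1 U f -> Ck_on k U f.
Proof.
elim: k f => [|k IH] f [df ddf] /=.
  by move=> x /df; exact: differentiable_continuous.
by split=> // v; exact: IH.
Qed.

Lemma Ck_on_cst V W k (U : set V) (w : W) : Ck_on k U (fun=> w).
Proof.
elim: k w => [|k IH] w /=; first by move=> x _; exact: cst_continuous.
split=> [x _|v]; first exact: differentiable_cst.
rewrite (_ : (fun _ => _) = fun=> 0) //; apply/funext => x.
by rewrite (diff_cst w).
Qed.

Lemma Ck_onD V W k (U : set V) (f g : V -> W) : open U ->
  Ck_on k U f -> Ck_on k U g -> Ck_on k U (fun x => f x + g x).
Proof.
move=> oU; elim: k f g => [|k IH] f g /=.
  by move=> cf cg x Ux; apply: continuousD; [exact: cf|exact: cg].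
case=> df ddf [dg ddg]; split=> [x Ux|v].
  by apply: differentiableD; [exact: df|exact: dg].
apply: Ck_on_eq (IH _ _ (ddf v) (ddg v)) => // x Ux.
exact/esym/(congr1 (@^~ v) (diffD (df _ Ux) (dg _ Ux))).
Qed.

Lemma Ck_onM V k (U : set V) (f g : V -> R) : open U ->
  Ck_on k U f -> Ck_on k U g -> Ck_on k U (fun x => f x * g x).
Proof.
move=> oU; elim: k f g => [|k IH] f g /=.
  by move=> cf cg x Ux; apply: continuousM; [exact: cf|exact: cg].
move=> cf cg; have [df ddf] := cf; have [dg ddg] := cg.
split=> [x Ux|v].
  by apply: differentiableM; [exact: df|exact: dg].
apply: (@Ck_on_eq _ _ _ _ (fun x => f x * 'd g x v + g x * 'd f x v)) => //.
  by move=> x Ux; exact/esym/(congr1 (@^~ v) (diffM (df _ Ux) (dg _ Ux))).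
by apply: Ck_onD => //; apply: IH => //; exact: Ck_onW.
Qed.

Lemma Ck_onZl V W k (U : set V) (f : V -> R) (w : W) : open U ->
  Ck_on k U f -> Ck_on k U (fun x => f x *: w).
Proof.
move=> oU; elim: k f => [|k IH] f /=.
  move=> cf x Ux; apply: (@continuous_comp _ _ _ f ( *:%R^~ w)); first exact: cf.
  exact: scalel_continuous.
case=> df ddf; split=> [x Ux|v].
  by apply: differentiableZl; exact: df.
apply: Ck_on_eq (IH _ (ddf v)) => // x Ux.
exact/esym/(congr1 (@^~ v) (diffZl w (df _ Ux))).
Qed.

Lemma Ck_on_sum V W k (U : set V) I (r : seq I) (f : I -> V -> W) : open U ->
  (forall i, Ck_on k U (f i)) -> Ck_on k U (fun x => \sum_(i <- r) f i x).
Proof.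
move=> oU cf; elim: r => [|i r IH].
  apply: Ck_on_eq (Ck_on_cst k U 0) => // x _; by rewrite big_nil.
by apply: Ck_on_eq (Ck_onD oU (cf i) IH) => // x _; rewrite big_cons.
Qed.

Lemma Ck_on_coord V m k (U : set V) (f : V -> 'rV[R]_m) i : open U ->
  Ck_on k U f -> Ck_on k U (fun x => f x 0 i).
Proof.
move=> oU; elim: k f => [|k IH] f /=.
  move=> cf x Ux; apply: (@continuous_comp _ _ _ f (fun w : 'rV_m => w 0 i)).
    exact: cf.
  exact: coord_continuous.
case=> df ddf.
have dfi x : U x ->
    differentiable (fun x => f x 0 i) x /\
    forall v, 'd (fun x => f x 0 i) x v = 'd f x v 0 i.
  move=> Ux.
  have dc : differentiable (fun w : 'rV[R]_m => w 0 i : R) (f x).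
    exact: differentiable_coord.
  split.
    exact: (differentiable_comp (df _ Ux) dc).
  move=> v; rewrite -deriveE; last exact: (differentiable_comp (df _ Ux) dc).
  rewrite -(deriveE v (df _ Ux)) derive_mx ?mxE//; exact/diff_derivable/df.
split=> [x /dfi[]//|v].
by apply: Ck_on_eq (IH _ (ddf v)) => // x /dfi[_ ->].
Qed.

Lemma Ck_on_row V m k (U : set V) (f : V -> 'rV[R]_m) : open U ->
  (forall i, Ck_on k U (fun x => f x 0 i)) -> Ck_on k U f.
Proof.
move=> oU cf.
apply: (@Ck_on_eq _ _ _ _ (fun x => \sum_i f x 0 i *: ('e_i : 'rV[R]_m))) => //.
  by move=> x _; rewrite -row_sum_delta.
by apply: Ck_on_sum => // i; exact: Ck_onZl.
Qed.

Lemma Ck_onZ V m k (U : set V) (f : V -> R) (g : V -> 'rV[R]_m) : open U ->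
  Ck_on k U f -> Ck_on k U g -> Ck_on k U (fun x => f x *: g x).
Proof.
move=> oU cf cg; apply: Ck_on_row => // i.
apply: (@Ck_on_eq _ _ _ _ (fun x => f x * g x 0 i)) => //.
  by move=> x _; rewrite mxE.
by apply: Ck_onM => //; exact: Ck_on_coord.
Qed.

(** [Ck_on] speaks only of derivatives in fixed directions; this expansion reduces to them a
    derivative whose direction moves with the point. *)
Lemma diff_sum_delta m W (g : 'rV[R]_m -> W) x v :
  'd g x v = \sum_(i < m) v 0 i *: 'd g x 'e_i.
Proof.
rewrite [in LHS](row_sum_delta v) linear_sum; apply: eq_bigr => i _.
by rewrite linearZ.
Qed.

Lemma diff_compE V W W' (f : V -> W) (g : W -> W') x v :
  differentiable f x -> differentiable g (f x) ->
  'd (fun y => g (f y)) x v = 'd g (f x) ('d f x v).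
Proof.
by move=> df dg; exact: (congr1 (@^~ v) (diff_comp df dg)).
Qed.

Lemma Ck_on_comp V m k (U : set V) (U' : set 'rV[R]_m) (f : V -> 'rV[R]_m)
    (g : 'rV[R]_m -> R) : open U -> (forall x, U x -> U' (f x)) ->
  Ck_on k U f -> Ck_on k U' g -> Ck_on k U (fun x => g (f x)).
Proof.
move=> oU fU; elim: k g => [|k IH] g /=.
  move=> cf cg x Ux; apply: (@continuous_comp _ _ _ f g); first exact: cf.
  by apply: cg; exact: fU.
move=> cf; have [df ddf] := cf; case=> dg ddg; split=> [x Ux|v].
  by apply: (@differentiable_comp _ _ _ _ f g); [exact: df|exact/dg/fU].
apply: (@Ck_on_eq _ _ _ _
  (fun x => \sum_(i < m) 'd f x v 0 i * 'd g (f x) 'e_i)) => //.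
  move=> x Ux; rewrite (diff_compE v (df _ Ux) (dg _ (fU _ Ux))).
  by rewrite [RHS]diff_sum_delta.
apply: Ck_on_sum => // i; apply: Ck_onM => //.
  exact: Ck_on_coord.
by apply: (IH (fun y => 'd g y 'e_i)); [exact: (@Ck_onW _ _ k)|exact: ddg].
Qed.

Lemma Ck_on_comp_rV V m n k (U : set V) (U' : set 'rV[R]_m)
    (f : V -> 'rV[R]_m) (g : 'rV[R]_m -> 'rV[R]_n) :
  open U -> open U' -> (forall x, U x -> U' (f x)) ->
  Ck_on k U f -> Ck_on k U' g -> Ck_on k U (fun x => g (f x)).
Proof.
move=> oU oU' fU cf cg; apply: Ck_on_row => // i.
exact: (Ck_on_comp oU fU cf (Ck_on_coord i oU' cg)).
Qed.

Lemma Ck_on_comp_R V k (U : set V) (U' : set R) (f : V -> R) (g : R -> R) :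
  open U -> (forall x, U x -> U' (f x)) ->
  Ck_on k U f -> Ck_on k U' (g : R -> R) -> Ck_on k U (fun x => g (f x)).
Proof.
move=> oU fU; elim: k g => [|k IH] g /=.
  move=> cf cg x Ux; apply: (@continuous_comp _ _ _ f g); first exact: cf.
  by apply: cg; exact: fU.
move=> cf; have [df ddf] := cf; case=> dg ddg; split=> [x Ux|v].
  by apply: (@differentiable_comp _ _ _ _ f g); [exact: df|exact/dg/fU].
apply: (@Ck_on_eq _ _ _ _ (fun x => 'd f x v * 'd g (f x) 1)) => //.
  move=> x Ux; rewrite (diff_compE v (df _ Ux) (dg _ (fU _ Ux))).
  by rewrite -[in RHS](mulr1 ('d f x v)) [RHS]linearZ.
apply: Ck_onM => //.
by apply: (IH (fun y => 'd g y 1)); [exact: (@Ck_onW _ _ k)|exact: ddg].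
Qed.

Lemma Ck_on_diff_apply m k (U : set 'rV[R]_m) (f : 'rV[R]_m -> R)
    (h : 'rV[R]_m -> 'rV[R]_m) : open U ->
  Ck_on k.+1 U f -> Ck_on k U h -> Ck_on k U (fun x => 'd f x (h x)).
Proof.
move=> oU [_ cf] ch.
apply: (@Ck_on_eq _ _ _ _ (fun x => \sum_(i < m) h x 0 i * 'd f x 'e_i)) => //.
  by move=> x Ux; rewrite [RHS]diff_sum_delta.
by apply: Ck_on_sum => // i; apply: Ck_onM => //; [exact: Ck_on_coord|exact: cf].
Qed.

Lemma Ck_on_diff_apply_rV m n k (U : set 'rV[R]_m) (f : 'rV[R]_m -> 'rV[R]_n)
    (h : 'rV[R]_m -> 'rV[R]_m) : open U ->
  Ck_on k.+1 U f -> Ck_on k U h -> Ck_on k U (fun x => 'd f x (h x)).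
Proof.
move=> oU [_ cf] ch.
apply: (@Ck_on_eq _ _ _ _ (fun x => \sum_(i < m) h x 0 i *: 'd f x 'e_i)) => //.
  by move=> x Ux; rewrite [RHS]diff_sum_delta.
by apply: Ck_on_sum => // i; apply: Ck_onZ => //; [exact: Ck_on_coord|exact: cf].
Qed.

(** * Symmetry of second derivatives *)

Lemma is_derive_line V (h : V -> R) (p u : V) (t : R) :
  differentiable h (p + t *: u) ->
  is_derive t 1 (fun s : R => h (p + s *: u)) ('d h (p + t *: u) u).
Proof.
move=> dh.
have [dl dlE] : is_diff t (cst p + *:%R^~ u) (0 + *:%R^~ u).
  exact: is_diffD.
have dhl : differentiable (fun s : R => h (p + s *: u)) t.
  exact: (differentiable_comp dl dh).
apply: DeriveDef; first exact: diff_derivable.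
rewrite deriveE // (diff_compE _ dl dh) dlE.
by congr ('d h _ _); rewrite fctE /= add0r scale1r.
Qed.

(** The mean value theorem twice: for [F], a difference in the direction [v], as a function of the
    step along [u]; then for the derivative along [u], as a function of the step along [v]. *)
Lemma second_difference V (U : set V) (f : V -> R) x u v (s : R) :
  Ck_on 2 U f -> 0 < s ->
  (forall a b, 0 <= a <= s -> 0 <= b <= s -> U (x + a *: u + b *: v)) ->
  exists a b, [/\ 0 <= a <= s, 0 <= b <= s &
    f (x + s *: u + s *: v) - f (x + s *: u) - f (x + s *: v) + f x =
    s * s * 'd (fun y => 'd f y u) (x + a *: u + b *: v) v].
Proof.
move=> [df ddf] s0 sU.
pose F t := f (x + t *: u + s *: v) - f (x + t *: u).
pose dF t := 'd f (x + t *: u + s *: v) u - 'd f (x + t *: u) u.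
have ss : 0 <= s <= s by rewrite lexx ltW.
have FdF t : 0 <= t <= s -> is_derive t 1 F (dF t).
  move=> ts; rewrite /F /dF; apply: is_deriveB.
    have -> : (fun t => f (x + t *: u + s *: v)) = (fun t => f (x + s *: v + t *: u)).
      by apply/funext => r; rewrite addrAC.
    rewrite addrAC; apply: is_derive_line.
    by rewrite addrAC; apply/df/sU.
  apply: is_derive_line; apply: df.
  by have := sU t 0 ts; rewrite scale0r addr0; apply; rewrite lexx ltW.
have [] := @MVT _ F dF 0 s s0.
- by move=> t; rewrite in_itv /= => /andP[/ltW t0 /ltW t1]; apply: FdF; rewrite t0.
- apply: derivable_within_continuous => t; rewrite in_itv /= => ts.
  by have [] := FdF t ts.
move=> a; rewrite in_itv /= => /andP[/ltW a0 /ltW a1].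
rewrite subr0 => Fa.
have as_ : 0 <= a <= s by rewrite a0.
pose G t := 'd f (x + a *: u + t *: v) u.
pose dG t := 'd (fun y => 'd f y u) (x + a *: u + t *: v) v.
have GdG t : 0 <= t <= s -> is_derive t 1 G (dG t).
  move=> ts; apply: (@is_derive_line _ (fun y => 'd f y u)).
  by have [+ _] := ddf u; apply; exact: sU.
have [] := @MVT _ G dG 0 s s0.
- by move=> t; rewrite in_itv /= => /andP[/ltW t0 /ltW t1]; apply: GdG; rewrite t0.
- apply: derivable_within_continuous => t; rewrite in_itv /= => ts.
  by have [] := GdG t ts.
move=> b; rewrite in_itv /= => /andP[/ltW b0 /ltW b1].
rewrite subr0 => Gb.
exists a, b; split=> //; first by rewrite b0.
have -> : f (x + s *: u + s *: v) - f (x + s *: u) - f (x + s *: v) + f x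
    = F s - F 0.
  by rewrite /F scale0r addr0 opprB addrA addrAC.
rewrite Fa.
have -> : dF a = G s - G 0 by rewrite /G scale0r addr0.
by rewrite Gb -mulrA mulrC /dG.
Qed.

(* Schwarz: both mixed derivatives are limits of the same second difference. *)
Lemma diff_diffC V (U : set V) (f : V -> R) x u v :
  open U -> Ck_on 2 U f -> U x ->
  'd (fun y => 'd f y u) x v = 'd (fun y => 'd f y v) x u.
Proof.
move=> oU cf Ux.
have cA (a b : V) : {for x, continuous (fun z => 'd (fun y => 'd f y a) z b)}.
  by have [_ /(_ a) [_ /(_ b)]] := cf; apply.
apply/eqP; rewrite -subr_eq0 -normr_le0; apply/ler_addgt0Pr => e e0.
rewrite add0r.
have e2 : 0 < e / 2 by rewrite divr_gt0.
have /cvgrPdist_lt /(_ _ e2) cuv := cA u v.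
have /cvgrPdist_lt /(_ _ e2) cvu := cA v u.
have nU : nbhs x U by apply: open_nbhs_nbhs.
have [r /= r0 br] : nbhs_ball x (fun z => [/\ U z,
    `|'d (fun y => 'd f y u) x v - 'd (fun y => 'd f y u) z v| < e / 2 &
    `|'d (fun y => 'd f y v) x u - 'd (fun y => 'd f y v) z u| < e / 2]).
  by apply/nbhs_ballP; near=> z; split; near: z.
(* With steps up to [s] the parallelogram stays in the ball of radius [r]; the summand 1 keeps the
   denominator positive when [u] and [v] vanish. *)
pose s := r / (1 + `|u| + `|v|).
have n0 : 0 < 1 + `|u| + `|v| by rewrite -addrA ltr_pwDl // addr_ge0.
have s0 : 0 < s by rewrite divr_gt0.
have small a b : 0 <= a <= s -> 0 <= b <= s -> ball x r (x + a *: u + b *: v).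
  move=> /andP[a0 a1] /andP[b0 b1].
  rewrite -ball_normE /= -addrA opprD addrA subrr sub0r normrN.
  apply: le_lt_trans (ler_normD _ _) _; rewrite !normrZ !ger0_norm //.
  apply: (@le_lt_trans _ _ (s * `|u| + s * `|v|)).
    by apply: lerD; apply: ler_wpM2r.
  by rewrite -mulrDr /s mulrAC ltr_pdivrMr // ltr_pM2l // -addrA ltrDr.
have [|a [b [aI bI E1]]] := second_difference (u := u) (v := v) (x := x) cf s0.
  by move=> a b aI bI; have [] := br _ (small _ _ aI bI).
have [|a' [b' [aI' bI' E2]]] := second_difference (u := v) (v := u) (x := x) cf s0.
  by move=> a' b' aI' bI'; rewrite addrAC; have [] := br _ (small _ _ bI' aI').
have [_ H1 _] := br _ (small _ _ aI bI).
have [_ _ H2] := br _ (small _ _ bI' aI').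
have : s * s * 'd (fun y => 'd f y u) (x + a *: u + b *: v) v =
       s * s * 'd (fun y => 'd f y v) (x + b' *: u + a' *: v) u.
  rewrite -E1 [x + b' *: u + _]addrAC -E2; rewrite (addrAC x); ring.
have ss0 : s * s != 0 by rewrite mulf_neq0 // gt_eqF.
move=> /(mulfI ss0) E.
rewrite E in H1.
rewrite (splitr e).
rewrite -(subrKA ('d (fun y => 'd f y v) (x + b' *: u + a' *: v) u)).
apply: le_trans (ler_normD _ _) _; apply: lerD; first exact: ltW.
by rewrite distrC ltW.
Unshelve. all: by end_near. Qed.
(* Closed under derivation:
   (P(1/t) e^(-1/t))' = Q(1/t) e^(-1/t) with Q = X^2 (P - P'). *)
Definition flat (P : {poly R}) (t : R) : R :=
  if 0 < t then P.[t^-1] * expR (- t^-1) else 0.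

(** From the term of degree [n.+2] of the exponential series. The two extra degrees leave a factor
    t^2 once s = 1/t. *)
Lemma exprn_expRN_le (s : R) n : 0 < s ->
  s ^+ n * expR (- s) <= n.+2`!%:R * s^-1 ^+ 2.
Proof.
move=> s0; rewrite expRN ler_pdivrMr ?expR_gt0 //.
have f0 : 0 < (n.+2)`!%:R :> R by rewrite ltr0n fact_gt0.
have : s ^+ n.+2 <= n.+2`!%:R * expR s.
  rewrite -ler_pdivrMl // mulrC.
  by apply: le_trans (expR_ge1Dxn n.+1 (ltW s0)); rewrite lerDr.
rewrite -addn2 exprD mulrAC exprVn => H.
by rewrite ler_pdivlMr ?exprn_gt0.
Qed.

(** The quadratic bound serves at the origin: it makes the difference quotient of [flat P] tend to 0
    there. *)
Lemma flat_le_sqr P : exists2 C, 0 <= C & forall t, `|flat P t| <= C * t ^+ 2.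
Proof.
pose C := \sum_(i < size P) `|P`_i| * i.+2`!%:R.
have C0 : 0 <= C by apply: sumr_ge0 => i _; rewrite mulr_ge0.
exists C => // t; rewrite /flat; case: ifPn => [t0|_]; last first.
  by rewrite normr0 mulr_ge0 // sqr_ge0.
rewrite horner_coef mulr_suml mulr_suml.
apply: le_trans (ler_norm_sum _ _ _) _; apply: ler_sum => i _.
have it0 : 0 < t^-1 by rewrite invr_gt0.
rewrite -mulrA normrM -mulrA; apply: ler_wpM2l => //.
rewrite ger0_norm; last by rewrite mulr_ge0 ?exprn_ge0 ?expR_ge0 // ltW.
by apply: le_trans (exprn_expRN_le i it0) _; rewrite invrK.
Qed.

Lemma is_derive_flat P (t : R) :
  is_derive t 1 (flat P) (flat ('X^2 * (P - P^`())) t).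
Proof.
have [t0|t0|->] := ltgtP t 0.
- rewrite {2}/flat ltNge (ltW t0) /=.
  apply: (@near_eq_is_derive R R^o R^o (cst 0)).
    near=> s; rewrite /flat ltNge ltW //=.
    by near: s; exact: lt_nbhsl.
- rewrite {2}/flat t0.
  have tn0 : t != 0 by rewrite gt_eqF.
  apply: (@near_eq_is_derive R R^o R^o (fun s => P.[s^-1] * expR (- s^-1))).
    near=> s; rewrite /flat ifT //.
    by near: s; exact: lt_nbhsr.
  have dV : is_derive t 1 (fun s : R => s^-1) (- t ^- 2).
    apply: DeriveDef; first exact: derivableV.
    by rewrite deriveV // derive_id [LHS]mulr1.
  have dP : is_derive t 1 (fun s : R => P.[s^-1]) (P^`().[t^-1] * - t ^- 2).
    exact: (@is_derive1_comp _ (horner P)).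
  have dE : is_derive t 1 (fun s : R => expR (- s^-1)) (expR (- t^-1) * - - t ^- 2).
    exact: (@is_derive1_comp _ expR).
  have := is_deriveM dP dE.
  rewrite (_ : P.[t^-1] *: _ + _ = ('X^2 * (P - P^`())).[t^-1] * expR (- t^-1)) //.
  rewrite !hornerE /GRing.scale /=. 
  rewrite exprVn; ring.
- rewrite {2}/flat ltxx.
  have [C C0 flatC] := flat_le_sqr P.
  have f0 : flat P 0 = 0 by rewrite /flat ltxx.
  have lim0 : (fun h : R => h^-1 *: (flat P (h *: 1 + 0) - flat P 0)) @ 0^' --> (0 : R).
    apply/cvgrPdist_le => e e0; near=> h.
    have hn0 : h != 0 by near: h; exact: nbhs_dnbhs_neq.
    (* [C] may be 0, hence the denominator [C + 1]. *)
    have he : `|h| <= e / (C + 1).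
      by near: h; apply: dnbhs0_le; rewrite divr_gt0 // ltr_pwDr.
    rewrite addr0 [_ *: 1]mulr1 f0 subr0 sub0r normrN [X in `|X|]/GRing.scale /=.
    rewrite normrM normfV ler_pdivrMl ?normr_gt0 //.
    apply: le_trans (flatC h) _; rewrite -(real_normK (num_real h)) expr2 mulrCA.
    apply: ler_wpM2l => //.
    have : (C + 1) * `|h| <= e by rewrite mulrC -ler_pdivlMr // ltr_pwDr.
    by apply: le_trans; apply: ler_wpM2r => //; rewrite lerDl.
  apply: DeriveDef; first by apply/cvg_ex; exists 0.
  exact: cvg_lim lim0.
Unshelve. all: by end_near. Qed.

Lemma Ck_on_flat P k : Ck_on k [set: R] (flat P : R -> R).
Proof.
elim: k P => [|k IH] P /=.
  move=> x _; apply: differentiable_continuous; apply/derivable1_diffP.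
  by have [] := is_derive_flat P x.
split=> [x _|v]; first by apply/derivable1_diffP; have [] := is_derive_flat P x.
apply: (@Ck_on_eq _ _ _ _ (fun x => v * flat ('X^2 * (P - P^`())) x)) => //.
- exact: openT.
- move=> x _; have [d E] := is_derive_flat P x.
  have df : differentiable (flat P) x by apply/derivable1_diffP.
  by rewrite -E deriveE // -[in RHS](mulr1 v) [RHS]linearZ.
apply: Ck_onM => //; [exact: openT|exact: Ck_on_cst].
Qed.

(** * Bump functions in coordinate space *)

Definition sqdist m (a z : 'rV[R]_m) : R := \sum_i (z 0 i - a 0 i) ^+ 2.

Definition smooth_bump m (a : 'rV[R]_m) (r : R) (z : 'rV[R]_m) : R :=
  flat 1 (r ^+ 2 - sqdist a z) / flat 1 (r ^+ 2).

Lemma Ck_on_id m k : Ck_on k [set: 'rV[R]_m] (id : 'rV[R]_m -> 'rV[R]_m).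
Proof.
case: k => [|k] /=; first by move=> x _; exact: cvg_id.
split=> [x _|v]; first by have [] := is_diff_id x.
rewrite (_ : (fun _ => _) = fun=> v); first exact: Ck_on_cst.
by apply/funext => x; have [_ ->] := is_diff_id x.
Qed.

Lemma Ck_on_smooth_bump m (a : 'rV[R]_m) r k : Ck_on k [set: 'rV[R]_m] (smooth_bump a r).
Proof.
have oT := @openT 'rV[R]_m.
apply: Ck_onM => //; last exact: Ck_on_cst.
apply: (@Ck_on_comp_R _ _ _ setT) => //; last exact: Ck_on_flat.
apply: (@Ck_on_eq _ _ _ _ (fun z => r ^+ 2 + -1 * sqdist a z)) => //.
  by move=> z _; rewrite mulN1r.
apply: Ck_onD => //; first exact: Ck_on_cst.
apply: Ck_onM => //; first exact: Ck_on_cst.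
apply: Ck_on_sum => // i.
have c : Ck_on k [set: 'rV[R]_m] (fun z : 'rV[R]_m => z 0 i - a 0 i).
  apply: Ck_onD => //; last exact: Ck_on_cst.
  exact: (Ck_on_coord i oT (@Ck_on_id m k)).
apply: (@Ck_on_eq _ _ _ _ (fun z : 'rV[R]_m => (z 0 i - a 0 i) * (z 0 i - a 0 i))) => //.
exact: Ck_onM.
Qed.

Lemma smooth_bump_center m (a : 'rV[R]_m) r : 0 < r -> smooth_bump a r a = 1.
Proof.
move=> r0; rewrite /smooth_bump /sqdist big1 => [|i _]; last by rewrite subrr expr0n.
by rewrite subr0 divff // /flat exprn_gt0 // hornerC mul1r gt_eqF // expR_gt0.
Qed.

Lemma smooth_bump_eq0 m (a z : 'rV[R]_m) r :
  0 < r -> r <= `|a - z| -> smooth_bump a r z = 0.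
Proof.
move=> r0 raz; rewrite /smooth_bump /flat ifF ?mul0r //.
apply/negbTE; rewrite -leNgt subr_le0.
(* The norm on row vectors is the maximum norm, whereas the bump uses the Euclidean [sqdist], a
   polynomial in the coordinates. One coordinate that attains the norm already makes [sqdist] at
   least [r ^+ 2]. *)
have [|[i j] E] := @mx_norm_neq0 _ _ _ (a - z).
  by rewrite gt_eqF // (lt_le_trans r0).
have {}raz : r <= `|(z - a) 0 j|.
  have : r <= mx_norm (a - z) := raz.
  by rewrite E /= ord1 -opprB mxE normrN.
rewrite /sqdist (bigD1 j) //= -[X in X <= _]addr0.
apply: lerD; last by apply: sumr_ge0 => k _; exact: sqr_ge0.
rewrite -[leRHS]real_normK ?num_real //; apply: lerXn2r; rewrite ?nnegrE ?(ltW r0) //.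
by move: raz; rewrite !mxE.
Qed.

Lemma diff_sumE V W I (r : seq I) (f : I -> V -> W) x v :
  (forall i, differentiable (f i) x) ->
  differentiable (fun y => \sum_(i <- r) f i y) x /\
  'd (fun y => \sum_(i <- r) f i y) x v = \sum_(i <- r) 'd (f i) x v.
Proof.
move=> df; elim: r => [|i r [IH IHE]].
  rewrite big_nil (_ : (fun _ => _) = cst 0); last by apply/funext => y; rewrite big_nil.
  by split; [exact: differentiable_cst|rewrite diff_cst].
rewrite big_cons (_ : (fun _ => _) = f i + (fun y => \sum_(j <- r) f j y)); last first.
  by apply/funext => y; rewrite big_cons.
split; first exact: differentiableD.
by rewrite -IHE; exact: (congr1 (@^~ v) (diffD (df i) IH)).
Qed.

(** The product rule for the pairing of ['d f z] with [h z]: the direction is frozen in the first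
    term and differentiated in the second. It serves to expand X(Y f) in coordinates. *)
Lemma diff_diff_apply m (U : set 'rV[R]_m) (f : 'rV[R]_m -> R)
    (h : 'rV[R]_m -> 'rV[R]_m) a u : open U -> Ck_on 2 U f -> Ck_on 1 U h -> U a ->
  'd (fun z => 'd f z (h z)) a u =
  'd (fun z => 'd f z (h a)) a u + 'd f a ('d h a u).
Proof.
move=> oU [df ddf] ch Ua.
have d2 i : differentiable (fun z => 'd f z 'e_i) a by have [+ _] := ddf 'e_i; apply.
have sumE (k : 'rV[R]_m -> 'rV[R]_m) : Ck_on 1 U k ->
    'd (fun z => 'd f z (k z)) a u =
    \sum_i (k a 0 i * 'd (fun z => 'd f z 'e_i) a u +
            'd f a 'e_i * 'd (fun z => k z 0 i) a u).
  move=> ck.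
  have dk i : differentiable (fun z => k z 0 i : R) a.
    by have [+ _] := Ck_on_coord i oU ck; apply.
  rewrite (_ : (fun _ => _) = fun z => \sum_i k z 0 i * 'd f z 'e_i); last first.
    by apply/funext => z; rewrite diff_sum_delta.
  pose F (i : 'I_m) (z : 'rV[R]_m) : R := k z 0 i * 'd f z 'e_i.
  have dF i : differentiable (F i) a by apply: differentiableM.
  have [_ E] := diff_sumE (index_enum _) u dF.
  transitivity (\sum_i 'd (F i) a u); first exact: E.
  apply: eq_bigr => i _.
  exact: (congr1 (@^~ u) (diffM (dk i) (d2 i))).
have E1 := sumE _ ch.
have E2 := sumE (fun=> h a) (Ck_on_cst 1 U (h a)).
apply: (etrans E1); apply/esym; apply: (etrans (congr1 (fun s => s + _) E2)).
apply: (etrans (congr1 (fun s => _ + s) (diff_sum_delta f a ('d h a u)))).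
have sumD (A B C : 'I_m -> R) : (forall i, A i + B i = C i) ->
    \sum_i A i + \sum_i B i = \sum_i C i.
  by move=> ABC; rewrite -big_split; apply: eq_bigr => i _; exact: ABC.
apply: sumD => i.
have c0 : 'd (fun=> h a 0 i) a u = 0 :> R.
  exact: (congr1 (@^~ u) (diff_cst (h a 0 i : R) a)).
have [dh _] := ch.
have c1 : 'd (fun z => h z 0 i) a u = ('d h a u) 0 i.
  rewrite -deriveE; last by have [+ _] := Ck_on_coord i oU ch; apply.
  by rewrite -(deriveE u (dh _ Ua)) derive_mx ?mxE//; exact/diff_derivable/dh.
have comb (p q r s t : R) : r = 0 -> s = t -> p + q * r + t * q = p + q * s.
  by move=> -> ->; ring.
exact: comb c0 c1.
Qed.

End Smooth.

(** * Smooth functions and fields on a manifold *)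

Section Manifold.
Context {R : realType} {m : nat} {M : smooth_manifold R m}.
Implicit Types (c : chart R m M) (x : M) (X Y Z : vfield M) (f : M -> R).

(** * Charts and transition maps *)

Definition overlap c c' : set 'rV[R]_m := c @` (cdom c `&` cdom c').

Definition jac c c' x (v : 'rV[R]_m) : 'rV[R]_m := 'd (c' \o cinv c) (c x) v.

Lemma chart_at_atlas x : atlas (chart_at x).
Proof. by have [] := projT2 (cid (atlas_cover x)). Qed.

Lemma chart_at_dom x : cdom (chart_at x) x.
Proof. by have [] := projT2 (cid (atlas_cover x)). Qed.

Lemma cinvK c x : atlas c -> cdom c x -> cinv c (c x) = x.
Proof. by move=> /atlas_chart[_ _ + _ _]; apply. Qed.

Lemma cimg_dom c z : atlas c -> cimg c z -> cdom c (cinv c z).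
Proof. by move=> ac [x dx <-]; rewrite cinvK. Qed.

Lemma cimg_cinvK c z : atlas c -> cimg c z -> c (cinv c z) = z.
Proof. by move=> ac [x dx <-]; rewrite cinvK. Qed.

Lemma open_cimg c : atlas c -> open (cimg c).
Proof. by move=> /atlas_chart[]. Qed.

Lemma overlapP c c' z : atlas c ->
  overlap c c' z <-> cimg c z /\ cdom c' (cinv c z).
Proof.
move=> ac; split=> [[x [dx dx'] <-]|[Iz dz]].
  by rewrite cinvK //; split=> //; exists x.
exists (cinv c z); last exact: cimg_cinvK.
by split=> //; exact: cimg_dom.
Qed.

Lemma open_cinv_preimage c (A : set M) : atlas c -> open A ->
  open (cimg c `&` cinv c @^-1` A).
Proof.
move=> ac oA; have [_ oI _ _ cI] := atlas_chart ac.
rewrite openE => z [Iz Az]; apply: filterI.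
  exact: open_nbhs_nbhs.
by apply: (cI _ Iz); exact: open_nbhs_nbhs.
Qed.

Lemma open_overlap c c' : atlas c -> atlas c' -> open (overlap c c').
Proof.
move=> ac ac'.
have -> : overlap c c' = cimg c `&` cinv c @^-1` cdom c'.
  by apply/seteqP; split=> z /(overlapP c' z ac).
by apply: open_cinv_preimage => //; have [] := atlas_chart ac'.
Qed.

Lemma Ck_on_transition c c' k : atlas c -> atlas c' ->
  Ck_on k (overlap c c') (c' \o cinv c).
Proof. by move=> ac ac'; exact: atlas_compat. Qed.

Lemma differentiable_transition c c' x : atlas c -> atlas c' ->
  cdom c x -> cdom c' x -> differentiable (c' \o cinv c) (c x).
Proof.
move=> ac ac' dx dx'; have [+ _] := Ck_on_transition 1 ac ac'.
by apply; exists x.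
Qed.

(** The chain rule for transition maps. It makes the readings of a tangent vector in different
    charts consistent, whatever chart the vector is stored in. *)
Lemma jac_comp a b d x v : atlas a -> atlas b -> atlas d ->
  cdom a x -> cdom b x -> cdom d x -> jac b d x (jac a b x v) = jac a d x v.
Proof.
move=> aa ab ad dax dbx ddx; rewrite /jac.
have E : {near a x, (d \o cinv b) \o (b \o cinv a) =1 d \o cinv a}.
  apply: (@open_eq_near R _ _ (overlap a b)).
  - exact: open_overlap.
  - by move=> z /(overlapP b z aa)[Iz dz] /=; rewrite cinvK.
  - by exists x.
have dab := differentiable_transition aa ab dax dbx.
have bax : (b \o cinv a) (a x) = b x by rewrite /= cinvK.
have dbd : differentiable (d \o cinv b) ((b \o cinv a) (a x)).
  by rewrite bax; exact: differentiable_transition.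
have [_ E'] := near_eq_diff E (differentiable_comp dab dbd).
rewrite -bax; apply: etrans (esym (congr1 (@^~ v) E')).
exact/esym/(diff_compE v dab dbd).
Qed.

Lemma jac_id c x v : atlas c -> cdom c x -> jac c c x v = v.
Proof.
move=> ac dx; rewrite /jac.
have E : {near c x, id =1 c \o cinv c}.
  apply: (@open_eq_near R _ _ (cimg c)); first exact: open_cimg.
    by move=> z Iz /=; rewrite cimg_cinvK.
  by exists x.
have [di dE] := is_diff_id (c x).
have [_ E'] := near_eq_diff E di.
exact: etrans (congr1 (@^~ v) E') (congr1 (@^~ v) dE).
Qed.

Lemma jac0 c c' x : jac c c' x 0 = 0.
Proof. exact: linear0. Qed.

Lemma jacZ c c' x a v : jac c c' x (a *: v) = a *: jac c c' x v.
Proof. exact: linearZ. Qed.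

Lemma coordE c x (v : tangent x) : Defs.coord c v = jac (chart_at x) c x v.
Proof. by []. Qed.

(** * Extension by zero from a chart *)

Definition lift_fun c (h : 'rV[R]_m -> R) : M -> R :=
  fun x => if `[< cdom c x >] then h (c x) else 0.

(** [jac] turns components in [c] into components in [chart_at x], the ones in which a field is
    stored. *)
Definition lift_vf c (h : 'rV[R]_m -> 'rV[R]_m) : vfield M :=
  fun x => if `[< cdom c x >] then jac c (chart_at x) x (h (c x)) else 0.

(** The points of [M] coming from [K] form a compact set, closed because [M] is Hausdorff. So the
    image of [c'] is covered by two open sets: the overlap with [c], where [F] is regular by
    hypothesis, and the complement of [K], where [F] is 0. *)
Lemma Ck_on_extend (W : normedModType R) k c c' (K : set 'rV[R]_m)
    (F : 'rV[R]_m -> W) : atlas c -> atlas c' ->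
  compact K -> K `<=` cimg c ->
  Ck_on k (overlap c' c) F ->
  (forall z, cimg c' z -> (cdom c (cinv c' z) -> ~ K (c (cinv c' z))) -> F z = 0) ->
  Ck_on k (cimg c') F.
Proof.
move=> ac ac' cK KI cF F0; apply: Ck_on_cover => z Iz.
have [dz|ndz] := pselect (cdom c (cinv c' z)).
  by exists (overlap c' c) => //; apply/overlapP.
have cL : closed (cinv c @` K).
  apply: compact_closed; first exact: manifold_hausdorff.
  apply: continuous_compact => //; apply: continuous_in_subspaceT => w /set_mem Kw.
  by have [_ _ _ _] := atlas_chart ac; apply; exact: KI.
pose U := cimg c' `&` cinv c' @^-1` (~` (cinv c @` K)).
have oU : open U by apply: open_cinv_preimage => //; exact: closed_openC.
exists U.
  split=> // -[w Kw wz]; apply: ndz; rewrite -wz; exact/cimg_dom/KI.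
apply: (@Ck_on_eq _ _ _ _ _ (fun=> 0)) (Ck_on_cst _ _ _) => // w [Iw nKw].
rewrite F0 // => dw Kw; apply: nKw; exists (c (cinv c' w)) => //.
by rewrite cinvK.
Qed.

Definition compactly_supported (W : zmodType) (D : set 'rV[R]_m) (h : 'rV[R]_m -> W) :=
  exists K, [/\ compact K, K `<=` D & forall z, ~ K z -> h z = 0].

Lemma smooth_lift_fun c h : atlas c -> smooth_on (cimg c) h ->
  compactly_supported (cimg c) h -> smooth_fun (lift_fun c h).
Proof.
move=> ac sh [K [cK KI h0]] c' ac' k.
apply: (Ck_on_extend ac ac' cK KI).
  have oO := open_overlap ac' ac.
  apply: (@Ck_on_eq _ _ _ _ _ (fun z => h ((c \o cinv c') z))) => //.
    by move=> z /(overlapP c z ac')[_ dz]; rewrite /lift_fun /=; case: asboolP.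
  apply: (Ck_on_comp oO _ (Ck_on_transition k ac' ac) (sh k)).
  by move=> z /(overlapP c z ac')[Iz dz] /=; exists (cinv c' z).
move=> z Iz; rewrite /= /lift_fun; case: asboolP => // dz nK; exact/h0/nK.
Qed.

Lemma vf_rep_lift c c' h z : atlas c -> atlas c' -> cimg c' z ->
  cdom c (cinv c' z) ->
  vf_rep c' (lift_vf c h) z = jac c c' (cinv c' z) (h ((c \o cinv c') z)).
Proof.
move=> ac ac' Iz dz; rewrite /vf_rep /lift_vf; case: asboolP => // _.
rewrite coordE jac_comp //.
- exact: chart_at_atlas.
- exact: chart_at_dom.
- exact: cimg_dom.
Qed.

Lemma smooth_lift_vf c h : atlas c -> smooth_on (cimg c) h ->
  compactly_supported (cimg c) h -> smooth_vf (lift_vf c h).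
Proof.
move=> ac sh [K [cK KI h0]] c' ac' k.
apply: (Ck_on_extend ac ac' cK KI).
  have oO := open_overlap ac' ac; have oO' := open_overlap ac ac'.
  pose T z := 'd (c' \o cinv c) z (h z).
  apply: (@Ck_on_eq _ _ _ _ _ (fun z => T ((c \o cinv c') z))) => //.
    move=> z /(overlapP c z ac')[Iz dz]; rewrite vf_rep_lift //.
  apply: (Ck_on_comp_rV oO oO' _ (Ck_on_transition k ac' ac)).
    move=> z /(overlapP c z ac')[Iz dz] /=; exists (cinv c' z) => //.
    by split=> //; exact: cimg_dom.
  apply: Ck_on_diff_apply_rV => //; first exact: Ck_on_transition.
  apply: Ck_on_sub (sh k) => z /(overlapP c' z ac)[]//.
move=> z Iz H; rewrite /vf_rep /lift_vf.
case: asboolP => dz; last by rewrite coordE jac0.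
by rewrite (h0 _ (H dz)) coordE !jac0.
Qed.

Lemma exists_bump c a : atlas c -> cimg c a ->
  exists b : 'rV[R]_m -> R,
    [/\ smooth_on setT b, b a = 1 & compactly_supported (cimg c) b].
Proof.
move=> ac Ia.
have [r /= r0 br] : nbhs_ball a (cimg c).
  by apply/nbhs_ballP; apply: open_nbhs_nbhs; split=> //; exact: open_cimg.
(* The closed ball of radius [r / 2] is compact and still lies in the open ball of radius [r],
   inside [cimg c]. *)
have r2 : 0 < r / 2 by rewrite divr_gt0.
exists (smooth_bump a (r / 2)); split.
- by move=> k; exact: Ck_on_smooth_bump.
- exact: smooth_bump_center.
exists [set z | `|a - z| <= r / 2]; split.
- apply: bounded_closed_compact.
    exists (`|a| + r / 2); split; first exact: num_real.
    move=> M' ltM z /= Hz; apply: ltW; apply: le_lt_trans ltM.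
    rewrite -(subrK a z) addrC; apply: le_trans (ler_normD _ _) _.
    by rewrite lerD2l distrC.
  exact: (@closed_closed_ball_ _ 'rV[R]_m a (r / 2)).
- move=> z /= Hz; apply: br; rewrite -ball_normE /=; apply: le_lt_trans Hz _.
  by rewrite ltr_pdivrMr // mulr2n mulrDr mulr1 ltrDl.
- move=> z /= /negP; rewrite -ltNge => /ltW; exact: smooth_bump_eq0.
Qed.

Lemma vf_repD c X Y z : vf_rep c (fun x => X x + Y x) z = vf_rep c X z + vf_rep c Y z.
Proof. exact: linearD. Qed.

Lemma vf_repZ c f X z : vf_rep c (fun x => f x *: X x) z = f (cinv c z) *: vf_rep c X z.
Proof. exact: linearZ. Qed.

Lemma smooth_funD f1 f2 : smooth_fun f1 -> smooth_fun f2 ->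
  smooth_fun (fun x => f1 x + f2 x).
Proof.
move=> s1 s2 c ac k; have oc := open_cimg ac.
exact: (Ck_onD oc (s1 c ac k) (s2 c ac k)).
Qed.

Lemma smooth_funM f1 f2 : smooth_fun f1 -> smooth_fun f2 ->
  smooth_fun (fun x => f1 x * f2 x).
Proof.
move=> s1 s2 c ac k; have oc := open_cimg ac.
exact: (Ck_onM oc (s1 c ac k) (s2 c ac k)).
Qed.

Lemma smooth_fun_cst a : smooth_fun (fun _ : M => a).
Proof. by move=> c ac k; exact: Ck_on_cst. Qed.

Lemma smooth_vfD X Y : smooth_vf X -> smooth_vf Y -> smooth_vf (fun x => X x + Y x).
Proof.
move=> s1 s2 c ac k; have oc := open_cimg ac.
apply: (Ck_on_eq oc) (Ck_onD oc (s1 c ac k) (s2 c ac k)) => z _.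
by rewrite vf_repD.
Qed.

Lemma smooth_vfZ f X : smooth_fun f -> smooth_vf X -> smooth_vf (fun x => f x *: X x).
Proof.
move=> s1 s2 c ac k; have oc := open_cimg ac.
apply: (Ck_on_eq oc) (Ck_onZ oc (s1 c ac k) (s2 c ac k)) => z _.
by rewrite vf_repZ.
Qed.

Lemma smooth_vf0 : smooth_vf (fun _ : M => 0).
Proof.
move=> c ac k; apply: (Ck_on_eq (open_cimg ac)) (Ck_on_cst _ _ 0) => z _.
by rewrite /vf_rep coordE jac0.
Qed.

Lemma smooth_vfN X : smooth_vf X -> smooth_vf (fun x => - X x).
Proof.
move=> sX; have := smooth_vfZ (smooth_fun_cst (-1)) sX.
by congr smooth_vf; apply/funext => x; rewrite scaleN1r.
Qed.

Lemma smooth_vfB X Y : smooth_vf X -> smooth_vf Y -> smooth_vf (fun x => X x - Y x).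
Proof. by move=> sX sY; apply: smooth_vfD => //; exact: smooth_vfN. Qed.

Lemma smooth_vf_sum I (r : seq I) (X : I -> vfield M) :
  (forall i, smooth_vf (X i)) -> smooth_vf (fun x => \sum_(i <- r) X i x).
Proof.
move=> sX; elim: r => [|i r IH].
  have := smooth_vf0; congr smooth_vf; apply/funext => x; by rewrite big_nil.
have := smooth_vfD (sX i) IH; congr smooth_vf; apply/funext => x.
by rewrite big_cons.
Qed.

Lemma compactly_supportedM (D : set 'rV[R]_m) (b h : 'rV[R]_m -> R) :
  compactly_supported D b -> compactly_supported D (fun z => b z * h z).
Proof. by move=> [K [cK KD b0]]; exists K; split=> // z /b0 ->; rewrite mul0r. Qed.

Lemma compactly_supportedZ (D : set 'rV[R]_m) (b : 'rV[R]_m -> R)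
    (h : 'rV[R]_m -> 'rV[R]_m) :
  compactly_supported D b -> compactly_supported D (fun z => b z *: h z).
Proof. by move=> [K [cK KD b0]]; exists K; split=> // z /b0 ->; rewrite scale0r. Qed.

Lemma smooth_lift_bumpM c (b h : 'rV[R]_m -> R) : atlas c -> smooth_on setT b ->
  compactly_supported (cimg c) b -> smooth_on (cimg c) h ->
  smooth_fun (lift_fun c (fun z => b z * h z)).
Proof.
move=> ac sb kb sh; apply: smooth_lift_fun => //; last exact: compactly_supportedM.
by move=> k; apply: (Ck_onM (open_cimg ac) _ (sh k)); apply: Ck_on_sub (sb k).
Qed.

Lemma smooth_lift_bumpZ c (b : 'rV[R]_m -> R) (v : 'rV[R]_m) : atlas c ->
  smooth_on setT b -> compactly_supported (cimg c) b ->
  smooth_vf (lift_vf c (fun z => b z *: v)).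
Proof.
move=> ac sb kb; apply: smooth_lift_vf => //; last first.
  exact: (compactly_supportedZ (fun=> v)).
by move=> k; apply: (Ck_onZl _ (open_cimg ac)); apply: Ck_on_sub (sb k).
Qed.

Lemma exists_smooth_vf x v : exists2 X, smooth_vf X & X x = v.
Proof.
have ac := chart_at_atlas x; have dx := chart_at_dom x.
have Ix : cimg (chart_at x) (chart_at x x) by exists x.
have [b [sb b1 kb]] := exists_bump ac Ix.
exists (lift_vf (chart_at x) (fun z => b z *: v)); first exact: smooth_lift_bumpZ.
by rewrite /lift_vf; case: asboolP => // _; rewrite b1 scale1r jac_id.
Qed.

Lemma vf_rep_chart_at X x : vf_rep (chart_at x) X (chart_at x x) = X x.
Proof.
have ac := chart_at_atlas x; have dx := chart_at_dom x.
by rewrite /vf_rep cinvK // coordE jac_id.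
Qed.

Lemma vf_rep_at c X x : atlas c -> cdom c x ->
  vf_rep c X (c x) = jac (chart_at x) c x (X x).
Proof. by move=> ac dx; rewrite /vf_rep cinvK. Qed.

(* C^oo(M)-linear maps act pointwise: near x write b^2 X = \sum_i (b X^i) (b d_i),
   where b is a bump function at x and the factors b X^i and b d_i are global. *)
Lemma tensorial_mx (F : vfield M -> vfield M) x :
  (forall X Y, smooth_vf X -> smooth_vf Y ->
     F (fun y => X y + Y y) x = F X x + F Y x) ->
  (forall f X, smooth_fun f -> smooth_vf X ->
     F (fun y => f y *: X y) x = f x *: F X x) ->
  exists A : 'M[R]_m, forall X, smooth_vf X -> F X x = X x *m A.
Proof.
move=> FD FZ; set c := chart_at x.
have ac := chart_at_atlas x; have dx := chart_at_dom x.
have Ix : cimg c (c x) by exists x.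
have [b [sb b1 kb]] := exists_bump ac Ix.
pose E i := lift_vf c (fun z => b z *: ('e_i : 'rV[R]_m)).
have sE i : smooth_vf (E i) by exact: smooth_lift_bumpZ.
have F0 : F (fun=> 0) x = 0.
  have := FZ (fun=> 0) (fun=> 0) (smooth_fun_cst 0) smooth_vf0.
  move=> FZ0; apply: etrans (etrans FZ0 (scale0r _)); congr (F _ x).
  by apply/funext => y; rewrite scale0r.
have Fsum (r : seq 'I_m) (X : 'I_m -> vfield M) : (forall i, smooth_vf (X i)) ->
    F (fun y => \sum_(i <- r) X i y) x = \sum_(i <- r) F (X i) x.
  move=> sX; elim: r => [|i r IH].
    by rewrite big_nil -[RHS]F0; congr (F _ x); apply/funext => y; rewrite big_nil.
  rewrite big_cons -IH -FD //; last exact: smooth_vf_sum.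
  by congr (F _ x); apply/funext => y; rewrite big_cons.
exists (\matrix_i F (E i) x) => X sX.
pose p := lift_fun c (fun z => b z * 1).
pose C i := lift_fun c (fun z => b z * vf_rep c X z 0 i).
have sp : smooth_fun p by apply: smooth_lift_bumpM => // k; exact: Ck_on_cst.
have sC i : smooth_fun (C i).
  apply: smooth_lift_bumpM => // k; apply: Ck_on_coord; first exact: open_cimg.
  exact: sX.
(* Both sides vanish off [cdom c], so the identity is global, as it must be for [F] to be applied to
   it. *)
have XE : (fun y => p y *: (p y *: X y)) = fun y => \sum_i C i y *: E i y.
  apply/funext => y; rewrite /p /C /E /lift_fun /lift_vf.
  case: asboolP => dy; last first.
    by rewrite !scale0r big1 // => i _; rewrite scaler0.
  have acy := chart_at_atlas y; have dcy := chart_at_dom y.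
  rewrite mulr1.
  transitivity (b (c y) *: (b (c y) *: jac c (chart_at y) y (vf_rep c X (c y)))).
    by rewrite vf_rep_at // jac_comp // jac_id.
  rewrite [in LHS](row_sum_delta (vf_rep c X (c y))).
  rewrite {1}/jac linear_sum !scaler_sumr; apply: eq_bigr => i _.
  by rewrite -/(jac _ _ _ _) !jacZ !scalerA; congr (_ *: _); ring.
have p1 : p x = 1 by rewrite /p /lift_fun; case: asboolP; rewrite // b1 mulr1.
transitivity (F (fun y => p y *: (p y *: X y)) x).
  by rewrite FZ ?FZ ?p1 ?scale1r //; exact: smooth_vfZ.
rewrite XE Fsum; last by move=> i; exact: smooth_vfZ.
rewrite [X x in RHS]row_sum_delta mulmx_suml; apply: eq_bigr => i _.
rewrite FZ // -scalemxAl -rowE rowK; congr (_ *: _).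
by rewrite /C /lift_fun; case: asboolP => // _; rewrite b1 mul1r vf_rep_chart_at.
Qed.

(** All matrices that [trace_field] may choose agree, since smooth fields take every value at
    [x]. *)
Lemma trace_field_eq (F : vfield M -> vfield M) x A :
  (forall X, smooth_vf X -> F X x = X x *m A) -> trace_field F x = \tr A.
Proof.
move=> FA; rewrite /trace_field; set P := [set _ | _].
have PA : P A by exact: FA.
have := xgetPex 0 (ex_intro P A PA); set B := xget _ _ => PB.
congr (\tr _); apply/row_matrixP => i; rewrite !rowE.
by have [X sX <-] := exists_smooth_vf x 'e_i; rewrite -FA // PB.
Qed.

(** * Vector fields as derivations *)

Lemma diff_coord i (a v : 'rV[R]_m) : 'd (fun z : 'rV[R]_m => z 0 i : R) a v = v 0 i.
Proof.
have dc : differentiable (fun z : 'rV[R]_m => z 0 i : R) a.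
  exact: differentiable_coord.
have D : derivable (id : 'rV[R]_m -> 'rV[R]_m) a v by exact: derivable_id.
have := derive_mx D.
rewrite derive_id => /matrixP/(_ 0 i); rewrite mxE => ->.
by rewrite deriveE.
Qed.

Lemma smooth_fun_Ck f c k : smooth_fun f -> atlas c -> Ck_on k (cimg c) (f \o cinv c).
Proof. by move=> sf ac; exact: sf. Qed.

Lemma differentiable_smooth f c x : smooth_fun f -> atlas c -> cdom c x ->
  differentiable (f \o cinv c) (c x).
Proof.
by move=> sf ac dx; have [+ _] := smooth_fun_Ck 1 sf ac; apply; exists x.
Qed.

(** [vf_act] uses a chart that changes with the point; its smoothness becomes visible once a fixed
    chart is shown to give the same value, by the chain rule. *)
Lemma vf_actE c X f x : smooth_fun f -> atlas c -> cdom c x ->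
  vf_act X f x = 'd (f \o cinv c) (c x) (vf_rep c X (c x)).
Proof.
move=> sf ac dx; rewrite vf_rep_at // /vf_act; set a := chart_at x.
have aa : atlas a := chart_at_atlas x; have dax : cdom a x := chart_at_dom x.
have E : {near a x, (f \o cinv c) \o (c \o cinv a) =1 f \o cinv a}.
  apply: (@open_eq_near R _ _ (overlap a c)).
  - exact: open_overlap.
  - by move=> z /(overlapP c z aa)[Iz dz] /=; rewrite cinvK.
  - by exists x.
have dac := differentiable_transition aa ac dax dx.
have cax : (c \o cinv a) (a x) = c x by rewrite /= cinvK.
have dfc : differentiable (f \o cinv c) ((c \o cinv a) (a x)).
  by rewrite cax; exact: differentiable_smooth.
have [_ E'] := near_eq_diff E (differentiable_comp dac dfc).
rewrite -cax; apply: etrans (congr1 (@^~ (X x)) E') _.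
exact: (diff_compE (X x) dac dfc).
Qed.

Lemma smooth_vf_act X f : smooth_vf X -> smooth_fun f -> smooth_fun (vf_act X f).
Proof.
move=> sX sf c ac k; have oc := open_cimg ac.
apply: (Ck_on_eq oc) (Ck_on_diff_apply oc (sf c ac k.+1) (sX c ac k)) => z Iz /=.
by rewrite (vf_actE X sf ac (cimg_dom ac Iz)) cimg_cinvK.
Qed.

Lemma vf_actD X f1 f2 x : smooth_fun f1 -> smooth_fun f2 ->
  vf_act X (fun y => f1 y + f2 y) x = vf_act X f1 x + vf_act X f2 x.
Proof.
move=> s1 s2; have ac := chart_at_atlas x; have dx := chart_at_dom x.
exact: (congr1 (@^~ (X x)) (diffD (differentiable_smooth s1 ac dx)
                                  (differentiable_smooth s2 ac dx))).
Qed.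

Lemma vf_actM X f1 f2 x : smooth_fun f1 -> smooth_fun f2 ->
  vf_act X (fun y => f1 y * f2 y) x = f1 x * vf_act X f2 x + f2 x * vf_act X f1 x.
Proof.
move=> s1 s2; have ac := chart_at_atlas x; have dx := chart_at_dom x.
apply: etrans (congr1 (@^~ (X x)) (diffM (differentiable_smooth s1 ac dx)
                                  (differentiable_smooth s2 ac dx))) _.
by rewrite !fctE /= cinvK.
Qed.

Lemma vf_act_cst X a x : vf_act X (fun=> a) x = 0.
Proof. exact: (congr1 (@^~ (X x)) (diff_cst (a : R) (chart_at x x))). Qed.

Lemma vf_actN X f x : smooth_fun f -> vf_act X (fun y => - f y) x = - vf_act X f x.
Proof.
move=> sf; have := vf_actM X x (smooth_fun_cst (-1)) sf.
rewrite vf_act_cst mulr0 addr0 mulN1r => <-.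
by congr (vf_act _ _ _); apply/funext => y; rewrite mulN1r.
Qed.

Lemma smooth_funN f : smooth_fun f -> smooth_fun (fun x => - f x).
Proof.
move=> sf; have := smooth_funM (smooth_fun_cst (-1)) sf.
by congr smooth_fun; apply/funext => x; rewrite mulN1r.
Qed.

Lemma smooth_funB f1 f2 : smooth_fun f1 -> smooth_fun f2 ->
  smooth_fun (fun x => f1 x - f2 x).
Proof. by move=> s1 s2; apply: smooth_funD => //; exact: smooth_funN. Qed.

Lemma vf_actB X f1 f2 x : smooth_fun f1 -> smooth_fun f2 ->
  vf_act X (fun y => f1 y - f2 y) x = vf_act X f1 x - vf_act X f2 x.
Proof. by move=> s1 s2; rewrite vf_actD ?vf_actN //; exact: smooth_funN. Qed.

Lemma vf_actDl X Y f x :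
  vf_act (fun y => X y + Y y) f x = vf_act X f x + vf_act Y f x.
Proof. exact: linearD. Qed.

Lemma vf_act_vf_act X Y f x : smooth_vf Y -> smooth_fun f ->
  let c := chart_at x in
  vf_act X (vf_act Y f) x =
  'd (fun z => 'd (f \o cinv c) z (Y x)) (c x) (X x) +
  'd (f \o cinv c) (c x) ('d (vf_rep c Y) (c x) (X x)).
Proof.
move=> sY sf c; have ac : atlas c := chart_at_atlas x.
have dx : cdom c x := chart_at_dom x.
have oc := open_cimg ac; have Ix : cimg c (c x) by exists x.
have E : {near c x, (fun z => 'd (f \o cinv c) z (vf_rep c Y z)) =1 vf_act Y f \o cinv c}.
  apply: (open_eq_near oc) => // z Iz /=.
  by rewrite (vf_actE Y sf ac (cimg_dom ac Iz)) cimg_cinvK.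
have [D _] := Ck_on_diff_apply oc (sf c ac 2) (sY c ac 1).
have [_ E'] := near_eq_diff E (D _ Ix).
rewrite {1}/vf_act; apply: etrans (congr1 (@^~ (X x)) E') _.
apply: etrans (diff_diff_apply (X x) oc (sf c ac 2) (sY c ac 1) Ix) _.
by rewrite vf_rep_chart_at.
Qed.

Lemma vf_act_bracket X Y f x : smooth_vf X -> smooth_vf Y -> smooth_fun f ->
  vf_act (lie_bracket X Y) f x = vf_act X (vf_act Y f) x - vf_act Y (vf_act X f) x.
Proof.
move=> sX sY sf; have ac := chart_at_atlas x; have dx := chart_at_dom x.
have Ix : cimg (chart_at x) (chart_at x x) by exists x.
rewrite (vf_act_vf_act X x sY sf) (vf_act_vf_act Y x sX sf).
have S := diff_diffC (X x) (Y x) (open_cimg ac) (sf _ ac 2) Ix.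
have L : vf_act (lie_bracket X Y) f x =
    'd (f \o cinv (chart_at x)) (chart_at x x)
      ('d (vf_rep (chart_at x) Y) (chart_at x x) (X x)) -
    'd (f \o cinv (chart_at x)) (chart_at x x)
      ('d (vf_rep (chart_at x) X) (chart_at x x) (Y x)).
  exact: linearB.
have comb (l a a' b d : R) : l = b - d -> a' = a -> l = a + b - (a' + d).
  by move=> -> ->; ring.
exact: comb L S.
Qed.

(* Test the field on the coordinate functions times a bump function. *)
Lemma vf_act_eq0 X x : (forall f, smooth_fun f -> vf_act X f x = 0) -> X x = 0.
Proof.
move=> Xf; have ac := chart_at_atlas x; have dx := chart_at_dom x.
have oc := open_cimg ac.
have Ix : cimg (chart_at x) (chart_at x x) by exists x.
have [b [sb b1 kb]] := exists_bump ac Ix.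
set c := chart_at x in ac dx oc Ix b1 kb *.
apply/rowP => i; rewrite mxE.
(* Subtracting the value at the point makes [h] vanish there, so the product rule for [b * h] leaves
   only the differential of [h]. *)
pose h (z : 'rV[R]_m) : R := z 0 i - c x 0 i.
have sh : smooth_on (cimg c) h.
  move=> k; apply: (Ck_onD oc); last exact: Ck_on_cst.
  apply: Ck_on_sub (Ck_on_coord i openT (@Ck_on_id R m k)); exact: subsetT.
have := Xf _ (smooth_lift_bumpM ac sb kb sh).
rewrite /vf_act -/c.
have E : {near c x, b * h =1 lift_fun c (fun z => b z * h z) \o cinv c}.
  apply: (open_eq_near oc) => // z Iz; rewrite /= /lift_fun.
  by case: asboolP => dz; rewrite ?cimg_cinvK //; case: dz; exact: cimg_dom.
have db : differentiable b (c x) by have [+ _] := sb 1; apply.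
have dc : differentiable (fun z : 'rV[R]_m => z 0 i : R) (c x).
  exact: differentiable_coord.
have dh : differentiable h (c x) by have [+ _] := sh 1; apply.
have [_ E'] := near_eq_diff E (differentiableM db dh).
move=> /(etrans (esym (congr1 (@^~ (X x)) E'))).
move=> /(etrans (esym (congr1 (@^~ (X x)) (diffM db dh)))).
have h0 : h (c x) = 0 by rewrite /h subrr.
have dhE : 'd h (c x) (X x) = X x 0 i.
  have dk : differentiable (cst (c x 0 i) : 'rV[R]_m -> R) (c x).
    exact: differentiable_cst.
  apply: etrans (congr1 (@^~ (X x)) (diffB dc dk)) _.
  have kE : 'd (cst (c x 0 i) : 'rV[R]_m -> R) (c x) (X x) = 0.
    exact: (congr1 (@^~ (X x)) (diff_cst (c x 0 i : R) (c x))).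
  have comb (a e v : R) : a = v -> e = 0 -> a - e = v by move=> -> ->; rewrite subr0.
  exact: comb (diff_coord i (c x) (X x)) kE.
have comb (p q r : R) : b (c x) * p + h (c x) * q = 0 -> p = r -> r = 0.
  by rewrite h0 b1 mul0r mul1r addr0 => -> <-.
by move=> /comb; apply.
Qed.

(** Brackets act on functions as commutators, whose Jacobi sum cancels, and a field that kills every
    smooth function at [x] vanishes at [x]. Smoothness of the brackets is a hypothesis here; the
    connection supplies it later. *)
Lemma jacobi X Y Z x : smooth_vf X -> smooth_vf Y -> smooth_vf Z ->
  smooth_vf (lie_bracket X Y) -> smooth_vf (lie_bracket Y Z) ->
  smooth_vf (lie_bracket Z X) ->
  lie_bracket X (lie_bracket Y Z) x + lie_bracket Y (lie_bracket Z X) x +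
  lie_bracket Z (lie_bracket X Y) x = 0.
Proof.
move=> sX sY sZ sXY sYZ sZX.
pose V : vfield M := fun x => lie_bracket X (lie_bracket Y Z) x +
  lie_bracket Y (lie_bracket Z X) x + lie_bracket Z (lie_bracket X Y) x.
apply: (@vf_act_eq0 V) => f sf.
transitivity (vf_act (lie_bracket X (lie_bracket Y Z)) f x +
  vf_act (lie_bracket Y (lie_bracket Z X)) f x +
  vf_act (lie_bracket Z (lie_bracket X Y)) f x); first by rewrite /V !vf_actDl.
have act2 A B C : smooth_vf A -> smooth_vf B -> smooth_vf C ->
    vf_act A (vf_act (lie_bracket B C) f) x =
    vf_act A (vf_act B (vf_act C f)) x - vf_act A (vf_act C (vf_act B f)) x.
  move=> sA sB sC; rewrite -vf_actB; try by do 2!apply: smooth_vf_act => //.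
  congr (vf_act _ _ _); apply/funext => y; exact: vf_act_bracket.
have sa1 A : smooth_vf A -> smooth_fun (vf_act A f) by move=> sA; exact: smooth_vf_act.
rewrite !vf_act_bracket //; try exact: sa1.
rewrite (act2 X Y Z) // (act2 Y Z X) // (act2 Z X Y) //.
have comb (a b c d e g : R) :
  a - b - (c - d) + (c - e - (g - b)) + (g - d - (a - e)) = 0 by ring.
exact: comb.
Qed.

End Manifold.

(** * Sasakian identities over an abstract ring of functions *)

(* A and V stand for C^oo(M) and for its module of smooth vector fields. *)
Section SasakianCalculus.
Context {A : comPzRingType} {V : lmodType A}.
Variables (act : V -> A -> A) (g : V -> V -> A) (nabla : V -> V -> V).
Implicit Types (a b : A) (X Y Z W : V).

(** With this bracket torsion-freeness holds by definition; the commutator and Jacobi laws become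
    the axioms [rc_act_bracket] and [rc_jacobi]. *)
Definition torsion_free_bracket X Y := nabla X Y - nabla Y X.
Local Notation "'[ X , Y ]" := (torsion_free_bracket X Y).

(* Locked, as nphi below: otherwise rewriting with the additivity of g and phi
   unfolds it. *)
Definition curv := locked (fun X Y Z =>
  nabla X (nabla Y Z) - nabla Y (nabla X Z) - nabla '[X, Y] Z).

Lemma curvE X Y Z :
  curv X Y Z = nabla X (nabla Y Z) - nabla Y (nabla X Z) - nabla '[X, Y] Z.
Proof. by rewrite /curv -lock. Qed.

(** [A] is an arbitrary commutative ring; absence of 2-torsion, [rc_half], takes the place of
    division by 2. *)
Record riemannian_calculus : Prop := {
  rc_half : forall a, a + a = 0 -> a = 0;
  rc_actB : forall X a b, act X (a - b) = act X a - act X b;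
  rc_act_bracket : forall X Y a, act '[X, Y] a = act X (act Y a) - act Y (act X a);
  rc_jacobi : forall X Y Z, '[X, '[Y, Z]] + '[Y, '[Z, X]] + '[Z, '[X, Y]] = 0;
  rc_g_linear : forall a X Y Z, g (a *: X + Y) Z = a * g X Z + g Y Z;
  rc_g_sym : forall X Y, g X Y = g Y X;
  rc_g_nondeg : forall X, (forall Y, g X Y = 0) -> X = 0;
  rc_nabla_linear : forall a X Y Z, nabla (a *: X + Y) Z = a *: nabla X Z + nabla Y Z;
  rc_nablaD : forall X Y Z, nabla X (Y + Z) = nabla X Y + nabla X Z;
  rc_leibniz : forall X a Y, nabla X (a *: Y) = act X a *: Y + a *: nabla X Y;
  rc_metric : forall X Y Z, act X (g Y Z) = g (nabla X Y) Z + g Y (nabla X Z) }.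

(** The form eta becomes [g X xi], and d eta occurs doubled, which clears the factor 1/2 of [ext_d].
    In [sc_normal] it is already replaced by its contact value. *)
Record sasakian_calculus (phi : {linear V -> V}) (xi : V) : Prop := {
  sc_phi2 : forall X, phi (phi X) = - X + g X xi *: xi;
  sc_xi_unit : g xi xi = 1;
  sc_phi_xi : phi xi = 0;
  sc_skew : forall X Y, g X (phi Y) = - g (phi X) Y;
  sc_contact : forall X Y,
    act X (g Y xi) - act Y (g X xi) - g '[X, Y] xi = g X (phi Y) + g X (phi Y);
  sc_normal : forall X Y, (g X (phi Y) + g X (phi Y)) *: xi +
    (phi (phi '[X, Y]) + '[phi X, phi Y] - phi '[phi X, Y] - phi '[X, phi Y]) = 0 }.

Hypothesis rc : riemannian_calculus.

(** * Formal consequences of the Riemannian axioms *)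

Lemma g0l X : g 0 X = 0.
Proof.
have := rc_g_linear rc 1 0 0 X.
by rewrite scaler0 addr0 mul1r -[LHS]addr0 => /addrI <-.
Qed.

Lemma gDl X Y Z : g (X + Y) Z = g X Z + g Y Z.
Proof. by rewrite -[X]scale1r rc_g_linear // mul1r scale1r. Qed.

Lemma gZl a X Z : g (a *: X) Z = a * g X Z.
Proof. by rewrite -[a *: X]addr0 rc_g_linear // g0l addr0. Qed.

Lemma gNl X Z : g (- X) Z = - g X Z.
Proof. by rewrite -scaleN1r gZl mulN1r. Qed.

Lemma gDr X Y Z : g Z (X + Y) = g Z X + g Z Y.
Proof. by rewrite !(rc_g_sym rc Z) gDl. Qed.

Lemma gZr a X Z : g Z (a *: X) = a * g Z X.
Proof. by rewrite !(rc_g_sym rc Z) gZl. Qed.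

Lemma gNr X Z : g Z (- X) = - g Z X.
Proof. by rewrite !(rc_g_sym rc Z) gNl. Qed.

Definition gE := (gDl, gNl, gZl, gDr, gNr, gZr).

(** Nondegeneracy turns an identity between fields into one between scalars, where [ring]
    applies. *)
Lemma g_ext X Y : (forall Z, g X Z = g Y Z) -> X = Y.
Proof.
move=> XY; apply/eqP; rewrite -subr_eq0; apply/eqP/(rc_g_nondeg rc) => Z.
by rewrite !gE XY subrr.
Qed.

Lemma nabla0l X : nabla 0 X = 0.
Proof.
have := rc_nabla_linear rc 1 0 0 X.
by rewrite scaler0 addr0 scale1r -[LHS]addr0 => /addrI <-.
Qed.

Lemma nablaDl X Y Z : nabla (X + Y) Z = nabla X Z + nabla Y Z.
Proof. by rewrite -[X]scale1r rc_nabla_linear // !scale1r. Qed.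

Lemma nablaZl a X Z : nabla (a *: X) Z = a *: nabla X Z.
Proof. by rewrite -[a *: X]addr0 rc_nabla_linear // nabla0l addr0. Qed.

Lemma nablaNl X Z : nabla (- X) Z = - nabla X Z.
Proof. by rewrite -scaleN1r nablaZl scaleN1r. Qed.

Lemma nabla0r X : nabla X 0 = 0.
Proof.
have := rc_nablaD rc X 0 0.
by rewrite addr0 -[LHS]addr0 => /addrI <-.
Qed.

Lemma nablaNr X Z : nabla X (- Z) = - nabla X Z.
Proof.
apply/eqP; rewrite -addr_eq0 -rc_nablaD //.
by rewrite [- Z + Z]addrC subrr nabla0r.
Qed.

Lemma nablaBr X Y Z : nabla X (Y - Z) = nabla X Y - nabla X Z.
Proof. by rewrite rc_nablaD // nablaNr. Qed.

Lemma act0 X : act X 0 = 0.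
Proof. by rewrite -[0 in LHS](subrr 0) rc_actB // subrr. Qed.

Lemma actN X a : act X (- a) = - act X a.
Proof. by rewrite -[- a]sub0r rc_actB // act0 sub0r. Qed.

Lemma actD X a b : act X (a + b) = act X a + act X b.
Proof. by rewrite -[b in LHS]opprK rc_actB // actN opprK. Qed.

Lemma curvDl X X' Y Z : curv (X + X') Y Z = curv X Y Z + curv X' Y Z.
Proof.
apply: g_ext => W; rewrite !curvE /torsion_free_bracket.
rewrite !(nablaDl, nablaNl, nablaBr, rc_nablaD rc) !gE; ring.
Qed.

Lemma curvZl a X Y Z : curv (a *: X) Y Z = a *: curv X Y Z.
Proof.
apply: g_ext => W; rewrite !curvE /torsion_free_bracket.
rewrite !(nablaDl, nablaNl, nablaZl, nablaBr, rc_nablaD rc, rc_leibniz rc) !gE.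
ring.
Qed.

Lemma curvNr X Y Z : curv X Y (- Z) = - curv X Y Z.
Proof. by rewrite !curvE !nablaNr !opprD. Qed.

Lemma curvC X Y Z : curv Y X Z = - curv X Y Z.
Proof.
apply: g_ext => W; rewrite !curvE /torsion_free_bracket !(nablaDl, nablaNl) !gE; ring.
Qed.

(** As brackets are differences of [nabla], the cyclic sum of curvatures is exactly the Jacobi
    sum. *)
Lemma bianchi X Y Z : curv X Y Z + curv Y Z X + curv Z X Y = 0.
Proof.
rewrite -[RHS](rc_jacobi rc X Y Z); apply: g_ext => W.
rewrite !curvE /torsion_free_bracket !(nablaDl, nablaNl, nablaBr) !gE; ring.
Qed.

(** Expand both sides of the commutator law for the function [g Z W] by metricity. *)
Lemma curv_skew X Y Z W : g (curv X Y Z) W = - g Z (curv X Y W).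
Proof.
have H := rc_act_bracket rc X Y (g Z W).
apply/eqP; rewrite -addr_eq0; apply/eqP.
have := subrr (act '[X, Y] (g Z W)); rewrite {2}H.
rewrite !(rc_metric rc) !actD !(rc_metric rc) => E.
rewrite -[RHS]oppr0 -[in RHS]E !curvE !gE; ring.
Qed.

(** * Covariant derivatives of xi and phi, and the Sasakian curvature *)

Variables (phi : {linear V -> V}) (xi : V).
Hypothesis sc : sasakian_calculus phi xi.
Local Notation eta X := (g X xi).

Definition nphi := locked (fun X Y => nabla X (phi Y) - phi (nabla X Y)).

Lemma nphiE X Y : nphi X Y = nabla X (phi Y) - phi (nabla X Y).
Proof. by rewrite /nphi -lock. Qed.

Lemma act_g_xi X Y : act X (eta Y) = eta (nabla X Y) + g Y (nabla X xi).
Proof. exact: rc_metric. Qed.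

Lemma eta_phi X : eta (phi X) = 0.
Proof. by rewrite -[LHS]opprK -(sc_skew sc) (sc_phi_xi sc) rc_g_sym // g0l oppr0. Qed.

Lemma phi_alt X Y : g X (phi Y) = - g Y (phi X).
Proof. by rewrite (sc_skew sc) (rc_g_sym rc). Qed.

Lemma phi3 X : phi (phi (phi X)) = - phi X.
Proof. by rewrite (sc_phi2 sc) eta_phi scale0r addr0. Qed.

(** [act] is not assumed to be a derivation; this comes from the Leibniz rule of [nabla] for
    [1 *: xi], paired with the unit field [xi]. *)
Lemma act1 X : act X 1 = 0.
Proof.
have := rc_leibniz rc X 1 xi; rewrite !scale1r => /eqP.
rewrite eq_sym -subr_eq0 addrK => /eqP E.
transitivity (g (act X 1 *: xi) xi); last by rewrite E g0l.
by rewrite gZl (sc_xi_unit sc) mulr1.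
Qed.

Lemma eta_nabla_xi X : eta (nabla X xi) = 0.
Proof.
apply: (rc_half rc); rewrite -[RHS](act1 X) -(sc_xi_unit sc) (rc_metric rc).
by rewrite [g xi _]rc_g_sym.
Qed.

Lemma contact_nabla X Y :
  g (nabla X xi) Y - g (nabla Y xi) X = g X (phi Y) + g X (phi Y).
Proof.
rewrite -(sc_contact sc) !act_g_xi /torsion_free_bracket !gE.
rewrite (rc_g_sym rc Y) (rc_g_sym rc X); ring.
Qed.

Lemma nabla_xi_xi : nabla xi xi = 0.
Proof.
apply: (rc_g_nondeg rc) => Y; have := contact_nabla xi Y.
rewrite (sc_skew sc) (sc_phi_xi sc) g0l oppr0 addr0 eta_nabla_xi subr0 //.
Qed.

(** Normality in tensorial form: once brackets are written with [nabla], the derivatives of [X] and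
    [Y] themselves cancel and only those of phi remain. *)
Lemma normal_nphi X Y :
  nphi (phi X) Y - nphi (phi Y) X + phi (nphi Y X) - phi (nphi X Y)
  + (g X (phi Y) + g X (phi Y)) *: xi = 0.
Proof.
rewrite -[RHS](sc_normal sc X Y) !nphiE /torsion_free_bracket !linearB /=.
by apply: g_ext => Z; rewrite !gE; ring.
Qed.

Lemma nphi_skew X Y Z : g (nphi X Y) Z = - g Y (nphi X Z).
Proof.
have := rc_metric rc X (phi Y) Z; have := rc_metric rc X Y (phi Z).
have -> : g (phi Y) Z = - g Y (phi Z) by rewrite (sc_skew sc) opprK.
rewrite actN => -> E; apply/eqP; rewrite -subr_eq0; apply/eqP.
have := subrr (- (g (nabla X Y) (phi Z) + g Y (nabla X (phi Z)))); rewrite {2}E => E'.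
rewrite -[RHS]oppr0 -[in RHS]E' !nphiE !gE.
have -> : g (phi (nabla X Y)) Z = - g (nabla X Y) (phi Z) by rewrite (sc_skew sc) opprK.
rewrite (sc_skew sc Y); ring.
Qed.

(* This is d(d eta) = 0. *)
Lemma nphi_cyclic X Y Z :
  g Y (nphi X Z) + g Z (nphi Y X) + g X (nphi Z Y) = 0.
Proof.
apply: (rc_half rc).
(* The invariant formula for the exterior derivative of 2 d eta: [ddeta] supplies its derivative
   terms and [deta] its bracket terms. Second derivatives cancel by the commutator law, iterated
   brackets by [J]. *)
have ddeta U W T : act U (act W (eta T)) - act U (act T (eta W)) - act U (eta '[W, T])
    = g (nabla U W) (phi T) + g (nabla U W) (phi T)
      + (g W (nabla U (phi T)) + g W (nabla U (phi T))).
  rewrite -!(rc_actB rc) (sc_contact sc) actD !(rc_metric rc); ring.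
have deta U W T : act '[U, W] (eta T) - act T (eta '[U, W]) - eta '['[U, W], T]
    = g '[U, W] (phi T) + g '[U, W] (phi T) by exact: sc_contact.
have J : eta '['[X, Y], Z] + eta '['[Y, Z], X] + eta '['[Z, X], Y] = 0.
  rewrite -[RHS]oppr0 -(g0l xi) -(rc_jacobi rc X Y Z) !gDl.
  rewrite !gNl; ring.
have := ddeta X Y Z; have := ddeta Y Z X; have := ddeta Z X Y.
have := deta X Y Z; have := deta Y Z X; have := deta Z X Y.
rewrite !(rc_act_bracket rc) => e1 e2 e3 e4 e5 e6.
transitivity
  ((g (nabla X Y) (phi Z) + g (nabla X Y) (phi Z)
      + (g Y (nabla X (phi Z)) + g Y (nabla X (phi Z))))
   + (g (nabla Y Z) (phi X) + g (nabla Y Z) (phi X)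
      + (g Z (nabla Y (phi X)) + g Z (nabla Y (phi X))))
   + (g (nabla Z X) (phi Y) + g (nabla Z X) (phi Y)
      + (g X (nabla Z (phi Y)) + g X (nabla Z (phi Y))))
   - (g '[X, Y] (phi Z) + g '[X, Y] (phi Z))
   - (g '[Y, Z] (phi X) + g '[Y, Z] (phi X))
   - (g '[Z, X] (phi Y) + g '[Z, X] (phi Y))).
  rewrite !nphiE /torsion_free_bracket !gE.
  rewrite (phi_alt Y (nabla X Z)) (phi_alt Z (nabla Y X)) (phi_alt X (nabla Z Y)).
  ring.
rewrite -e1 -e2 -e3 -e4 -e5 -e6 -[RHS]J; ring.
Qed.

(** A certificate for linear combinations: the goal follows from a known equation once the two
    differences agree, which [ring] checks. *)
Lemma lincomb (a b c d : A) : a = b -> c - d = a - b -> c = d.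
Proof. by move=> -> /eqP; rewrite subrr subr_eq0 => /eqP. Qed.

Lemma double_inj X Y : X + X = Y + Y -> X = Y.
Proof.
move=> E; apply: g_ext => Z; apply/eqP; rewrite -subr_eq0; apply/eqP.
apply: (rc_half rc); have := congr1 (g^~ Z) E; rewrite /= !gDl => E'.
by rewrite addrACA -opprD E' subrr.
Qed.

Lemma nphi_xi X : nphi X xi = - phi (nabla X xi).
Proof. by rewrite !nphiE (sc_phi_xi sc) nabla0r sub0r. Qed.

Lemma nphi0l X : nphi 0 X = 0.
Proof. by rewrite !nphiE !nabla0l linear0 subr0. Qed.

Lemma phi2_nabla_xi X : phi (phi (nabla X xi)) = - nabla X xi.
Proof. by rewrite (sc_phi2 sc) eta_nabla_xi scale0r addr0. Qed.

Lemma phi_nphi_xi Z : phi (nphi xi Z) = nabla Z xi + phi (nabla (phi Z) xi).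
Proof.
have := normal_nphi Z xi.
rewrite (sc_phi_xi sc) nphi0l !nphi_xi linearN /= phi2_nabla_xi (rc_g_sym rc) g0l.
move=> E; apply: g_ext => W; apply: (lincomb (congr1 (g^~ W) E)).
by rewrite /= !gE !g0l; ring.
Qed.

Lemma nphi_xi_l Z : nphi xi Z =
  - nabla (phi Z) xi - (phi (phi Z) + phi (phi Z)) - phi (nabla Z xi).
Proof.
apply: g_ext => Y.
have C := nphi_cyclic xi Y Z; have K := contact_nabla Y (phi Z).
have p2 : g Z (nphi Y xi) = g (nabla Y xi) (phi Z).
  by rewrite nphi_xi gNr (phi_alt Z) opprK.
have p3 : g xi (nphi Z Y) = g (phi (nabla Z xi)) Y.
  by rewrite (rc_g_sym rc) nphi_skew nphi_xi gNr opprK (rc_g_sym rc).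
rewrite (rc_g_sym rc Y) p2 p3 in C; rewrite (rc_g_sym rc Y) in K.
apply: (lincomb (congr2 (fun a b => a - b) C K)); rewrite !gE; ring.
Qed.

(** [phi_nphi_xi] (normality at (Z, xi)) and phi applied to [nphi_xi_l] (d(d eta) = 0 and contact)
    evaluate the same vector; comparing them gives 2 phi (nabla_(phi Z) xi) = 2 phi Z. Taking Z =
    phi X recovers X up to its xi-component, and nabla_xi xi = 0. *)
Lemma nabla_xi X : nabla X xi = - phi X.
Proof.
have phiB Z : phi (nabla (phi Z) xi) = phi Z.
  apply: double_inj; apply: g_ext => W; have := phi_nphi_xi Z.
  rewrite nphi_xi_l !linearB linearN /= linearD /= phi3 phi2_nabla_xi.
  move=> /(congr1 (g^~ W)) /= E; apply: (lincomb (esym E)); rewrite !gE; ring.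
have Bphi Z : nabla (phi Z) xi = - phi (phi Z).
  by rewrite -[LHS]opprK -phi2_nabla_xi phiB.
have := Bphi (phi X).
rewrite phi3 opprK (sc_phi2 sc) nablaDl nablaNl nablaZl nabla_xi_xi.
by rewrite scaler0 addr0 => <-; rewrite opprK.
Qed.

(** Applying the two exchanges alternately, three times each, restores the order of the arguments
    and changes the sign three times, so [e] equals its opposite. *)
Lemma braid_eq0 (e : V -> V -> V -> A) X Y Z :
  (forall X Y Z, e X Y Z = e Y X Z) -> (forall X Y Z, e X Y Z = - e X Z Y) ->
  e X Y Z = 0.
Proof.
move=> es ea; apply: (rc_half rc).
by rewrite [X in X + _]es ea (es _ _ X) ea (es Z) ea opprK (es X) addrC subrr.
Qed.

(** The defect of (nabla_X phi) Y from its expected value g(X,Y) xi - eta(Y) X. *)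
Let D X Y := nphi X Y - g X Y *: xi + eta Y *: X.
Let d X Y Z := g (D X Y) Z.

Let d_skew X Y Z : d X Y Z = - d X Z Y.
Proof.
rewrite /d /D !gE nphi_skew (rc_g_sym rc xi Z) (rc_g_sym rc xi Y).
by rewrite (rc_g_sym rc _ (nphi X Z)); ring.
Qed.

Let d_cyclic X Y Z : d X Y Z + d Y Z X + d Z X Y = 0.
Proof.
apply: (lincomb (esym (nphi_cyclic X Y Z))).
have s U W T : g W (nphi U T) = - g (nphi U W) T by rewrite nphi_skew opprK.
rewrite !s /d /D !gE (rc_g_sym rc xi X) (rc_g_sym rc xi Y) (rc_g_sym rc xi Z).
rewrite (rc_g_sym rc Y X) (rc_g_sym rc Z X) (rc_g_sym rc Z Y); ring.
Qed.

(** Obtained by differentiating phi^2 Y = -Y + eta(Y) xi along X. *)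
Let nphi_phi X Y :
  nphi X (phi Y) = - phi (nphi X Y) + g (nabla X xi) Y *: xi + eta Y *: nabla X xi.
Proof.
rewrite !nphiE (sc_phi2 sc Y) (rc_nablaD rc) nablaNr (rc_leibniz rc) act_g_xi.
rewrite linearB /= (sc_phi2 sc (nabla X Y)) (rc_g_sym rc _ Y).
by apply: g_ext => W; rewrite !gE; ring.
Qed.

(** By [nphi_phi] and [nabla_xi] the endomorphism [D X] anticommutes with phi, which is itself skew
    for [g]. *)
Let d_phi X Y Z : d X (phi Y) Z = d X Y (phi Z).
Proof.
rewrite /d /D nphi_phi nabla_xi eta_phi !gE.
rewrite (rc_g_sym rc xi (phi Z)) eta_phi !(sc_skew sc); ring.
Qed.

Let d_xi X Z : d X Z xi = 0.
Proof.
rewrite d_skew /d /D nphi_xi nabla_xi linearN /= opprK (sc_phi2 sc) (sc_xi_unit sc) !gE.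
ring.
Qed.

Let d_normal X Y Z :
  d (phi X) Y Z - d (phi Y) X Z - d Y X (phi Z) + d X Y (phi Z) = 0.
Proof.
have N := congr1 (g^~ Z) (normal_nphi X Y).
rewrite /= g0l !gE in N.
apply: (lincomb N).
rewrite /d /D !gE !(sc_skew sc _ Z) (sc_phi_xi sc) g0l (rc_g_sym rc Y X).
rewrite (rc_g_sym rc (phi Y) X) (sc_skew sc X Y); ring.
Qed.

(* By d_normal and d_skew, d(phi X,Y,Z) + d(X,phi Y,Z) is symmetric in X, Y and
   skew in Y, Z, hence zero; then d_cyclic at (phi X,Y,Z) and (X,phi Y,Z) give
   d(Z,phi X,Y) = 0. *)
Let d_eq0 X Y Z : d X Y Z = 0.
Proof.
have e0 U W T : d (phi U) W T + d U (phi W) T = 0.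
  apply: (@braid_eq0 (fun U W T => d (phi U) W T + d U (phi W) T)) => {}U {}W {}T.
    apply: (lincomb (d_normal U W T)); rewrite -!d_phi; ring.
  by rewrite d_skew (d_skew U) -d_phi; ring.
have c0 U W T : d T (phi U) W = 0.
  apply: (rc_half rc).
  have h1 := d_cyclic (phi U) W T; have h2 := d_cyclic U (phi W) T.
  have h3 := e0 U W T; have h4 := e0 W T U.
  rewrite -d_phi in h1; rewrite -d_phi in h2.
  apply: (lincomb (congr2 +%R (congr2 +%R h1 h2) (congr1 -%R (congr2 +%R h3 h4)))).
  ring.
(* Both factors phi move to [Z], where phi^2 Z = -Z + eta(Z) xi; [d_xi] removes the xi term. *)
have := c0 (phi Y) Z X.
rewrite !d_phi (sc_phi2 sc) {1}/d gDr gNr gZr -/(d X Y Z) -/(d X Y xi) d_xi.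
by rewrite mulr0 addr0 => /eqP; rewrite oppr_eq0 => /eqP.
Qed.

Lemma nabla_phi X Y : nabla X (phi Y) = phi (nabla X Y) + g X Y *: xi - eta Y *: X.
Proof.
apply: g_ext => Z; apply: (lincomb (d_eq0 X Y Z)).
by rewrite /d /D nphiE !gE; ring.
Qed.

(** Since nabla xi = - phi, the curvature on xi is minus the antisymmetrised nabla phi. *)
Lemma curv_xi X Y : curv X Y xi = eta Y *: X - eta X *: Y.
Proof.
rewrite !curvE /torsion_free_bracket !nabla_xi !nablaNr !nabla_phi !linearB /=.
apply: g_ext => Z; rewrite !gE (rc_g_sym rc Y X); ring.
Qed.

Lemma eta_curv X Y Z : eta (curv X Y Z) = eta X * g Y Z - eta Y * g X Z.
Proof. by rewrite curv_skew curv_xi !gE !(rc_g_sym rc Z); ring. Qed.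

(** The Ricci identity for phi: its antisymmetrised second covariant derivative, evaluated by
    [nabla_phi] and [nabla_xi]. *)
Lemma curv_phi X Y Z : curv X Y (phi Z) = phi (curv X Y Z) +
  g Z (phi X) *: Y - g Z (phi Y) *: X - g Y Z *: phi X + g X Z *: phi Y.
Proof.
rewrite !curvE !nabla_phi !(nablaBr, rc_nablaD rc, rc_leibniz rc) !nabla_phi.
rewrite !nabla_xi !(rc_metric rc) !nabla_xi /torsion_free_bracket !linearB /= !linearD /=.
apply: g_ext => W; rewrite !gE (rc_g_sym rc (nabla X Y) Z).
ring.
Qed.

Lemma killing X Y : act xi (g X Y) - g '[xi, X] Y - g X '[xi, Y] = 0.
Proof.
rewrite (rc_metric rc) /torsion_free_bracket !nabla_xi !gE (sc_skew sc X Y); ring.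
Qed.

Section Horizontal.
Variable E : V.
Hypothesis etaE : eta E = 0.

Lemma phi_phi_horizontal : phi (phi E) = - E.
Proof. by rewrite (sc_phi2 sc) etaE scale0r addr0. Qed.

Lemma g_phi_horizontal : g (phi E) (phi E) = g E E.
Proof. by rewrite (sc_skew sc) phi_phi_horizontal gNl opprK. Qed.

Lemma curv_xi_horizontal : curv xi E xi = - E.
Proof. by rewrite curv_xi etaE scale0r sub0r (sc_xi_unit sc) scale1r. Qed.

Lemma eta_curv_horizontal : eta (curv xi E E) = g E E.
Proof. by rewrite eta_curv etaE mul0r subr0 (sc_xi_unit sc) mul1r. Qed.

(** Apply phi to [curv_phi] at (Z, E, E). Then phi^2 creates a xi-component from the curvature and
    one from [Z]; by [eta_curv] they cancel. *)
Lemma phi_curv_horizontal Z : phi (curv Z E (phi E)) =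
  g E E *: Z - curv Z E E - g Z E *: E - g Z (phi E) *: phi E.
Proof.
have gEE : g E (phi E) = 0.
  apply: (rc_half rc); rewrite {1}(sc_skew sc) (rc_g_sym rc) addrC.
  by rewrite subrr.
rewrite curv_phi gEE scale0r subr0 !linearD /= linearN /= !linearZ /=.
rewrite !(sc_phi2 sc) eta_curv etaE mul0r subr0 scale0r addr0.
apply: g_ext => W; rewrite !gE (phi_alt E Z); ring.
Qed.

End Horizontal.

(* The endomorphism whose trace is 2 S^*(E, E), rewritten by the first Bianchi
   identity in terms of those whose traces are Ricci curvatures. *)
Lemma phi_curv_phi E Z : eta E = 0 -> phi (curv E (phi E) Z) =
  curv Z E E + curv Z (phi E) (phi E) - (g E E + g E E) *: Z
  + (g Z E + g Z E) *: E + (g Z (phi E) + g Z (phi E)) *: phi E.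
Proof.
move=> etaE.
have -> : curv E (phi E) Z = curv Z (phi E) E - curv Z E (phi E).
  have := bianchi E (phi E) Z; rewrite -addrA => /eqP.
  by rewrite addr_eq0 => /eqP ->; rewrite opprD (curvC Z (phi E)) opprK.
(* The same lemma for the horizontal field [phi E]: as phi (phi E) = - E, it provides the other
   Bianchi term, up to sign. *)
have := phi_curv_horizontal (eta_phi E) Z.
rewrite g_phi_horizontal // phi_phi_horizontal // curvNr linearN /= => H.
rewrite linearB /= phi_curv_horizontal // -[phi (curv Z (phi E) E)]opprK H.
apply: g_ext => W; rewrite !gE; ring.
Qed.

End SasakianCalculus.

(** * Traces and the soliton equation *)

Section RankOne.
Context {R : comNzRingType} {m : nat}.

(** Vectors are rows acted on from the right, so [form_col l *m w] is the matrix of the rank-one map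
    u |-> l(u) w. *)
Definition form_col (l : 'rV[R]_m -> R) : 'cV[R]_m := \col_i l 'e_i.

Lemma mul_form_col (l : {scalar 'rV[R]_m}) u : u *m form_col l = (l u)%:M.
Proof.
rewrite [u in RHS]row_sum_delta linear_sum; apply/matrixP => i j.
rewrite !ord1 !mxE mulr1n; apply: eq_bigr => k _.
by rewrite !mxE linearZ.
Qed.

Lemma mul_rank1 (l : {scalar 'rV[R]_m}) u (w : 'rV[R]_m) :
  u *m (form_col l *m w) = l u *: w.
Proof. by rewrite mulmxA mul_form_col mul_scalar_mx. Qed.

Lemma trace_rank1 (l : {scalar 'rV[R]_m}) (w : 'rV[R]_m) : \tr (form_col l *m w) = l w.
Proof. by rewrite mxtrace_mulC mul_form_col mxtrace_scalar. Qed.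

End RankOne.

(** * The ring of smooth functions and its module of smooth fields *)

Section SmoothAlgebra.
Context {R : realType} {m : nat} (M : smooth_manifold R m).

Definition smooth_fun_pred : {pred M -> R} := fun f => `[< smooth_fun f >].
Definition smooth_vf_pred : {pred M -> 'rV[R]_m} := fun X => `[< smooth_vf X >].

Lemma smooth_fun_subring : subring_closed smooth_fun_pred.
Proof.
split; first by apply/asboolP; exact: smooth_fun_cst.
  by move=> f h /asboolP sf /asboolP sh; apply/asboolP; exact: smooth_funB.
by move=> f h /asboolP sf /asboolP sh; apply/asboolP; exact: smooth_funM.
Qed.

Lemma smooth_vf_zmod : zmod_closed smooth_vf_pred.
Proof.
split; first by apply/asboolP; exact: smooth_vf0.
by move=> X Y /asboolP sX /asboolP sY; apply/asboolP; exact: smooth_vfB.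
Qed.

HB.instance Definition _ :=
  GRing.isSubringClosed.Build (M -> R) smooth_fun_pred smooth_fun_subring.
HB.instance Definition _ :=
  GRing.isZmodClosed.Build (M -> 'rV[R]_m) smooth_vf_pred smooth_vf_zmod.

Record sfun := SFun { sfun_val :> M -> R; sfunP : sfun_val \in smooth_fun_pred }.
HB.instance Definition _ := [isSub for sfun_val].
HB.instance Definition _ := [Choice of sfun by <:].
HB.instance Definition _ := 
  GRing.SubChoice_isSubComPzRing.Build (M -> R) smooth_fun_pred sfun smooth_fun_subring.

Record svf := SVf { svf_val :> M -> 'rV[R]_m; svfP : svf_val \in smooth_vf_pred }.
HB.instance Definition _ := [isSub for svf_val].
HB.instance Definition _ := [Choice of svf by <:].
HB.instance Definition _ := [SubChoice_isSubZmodule of svf by <:].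

Definition mk_sfun f (sf : smooth_fun f) : sfun := SFun (asboolT sf).
Definition mk_svf X (sX : smooth_vf X) : svf := SVf (asboolT sX).

Lemma sfun_smooth (f : sfun) : smooth_fun f.
Proof. exact: (asboolW (sfunP f)). Qed.

Lemma svf_smooth (X : svf) : smooth_vf X.
Proof. exact: (asboolW (svfP X)). Qed.

Lemma sfun_ext (f h : sfun) : (forall x, f x = h x) -> f = h.
Proof. by move=> fh; apply: val_inj; apply/funext. Qed.

Lemma svf_ext (X Y : svf) : (forall x, X x = Y x) -> X = Y.
Proof. by move=> XY; apply: val_inj; apply/funext. Qed.

Definition svf_scale (f : sfun) (X : svf) : svf :=
  mk_svf (smooth_vfZ (sfun_smooth f) (svf_smooth X)).

Fact svf_scaleA a b X : svf_scale a (svf_scale b X) = svf_scale (a * b) X.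
Proof. by apply: svf_ext => x; exact: scalerA. Qed.
Fact svf_scale1 : left_id 1 svf_scale.
Proof. by move=> X; apply: svf_ext => x; exact: scale1r. Qed.
Fact svf_scaleDr : right_distributive svf_scale +%R.
Proof. by move=> a X Y; apply: svf_ext => x; exact: scalerDr. Qed.
Fact svf_scaleDl X : {morph svf_scale^~ X : a b / a + b}.
Proof. by move=> a b; apply: svf_ext => x; exact: scalerDl. Qed.

HB.instance Definition _ := GRing.Zmodule_isLmodule.Build sfun svf
  svf_scaleA svf_scale1 svf_scaleDr svf_scaleDl.

End SmoothAlgebra.

(** * The manifold as a model of the abstract calculus, and its Ricci traces *)

Section Geometry.
Context {R : realType} {m : nat} {M : smooth_manifold R m}.
Context {phi : tensor11 M} {xi : vfield M} {eta : covector_field M} {g : tensor02 M}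
  {nabla : vfield M -> vfield M -> vfield M}.
Hypothesis (S : sasakian phi xi eta g) (L : levi_civita g nabla).
Implicit Types (X Y Z E : svf M) (x : M).

Let acm : almost_contact_metric phi xi eta g := sasakian_acm S.
Let rm : riemannian_metric g := acm_metric acm.

Definition act_s X (f : sfun M) : sfun M :=
  mk_sfun (smooth_vf_act (svf_smooth X) (sfun_smooth f)).
Definition g_s X Y : sfun M := mk_sfun (metric_smooth rm (svf_smooth X) (svf_smooth Y)).
Definition nabla_s X Y : svf M := mk_svf (conn_smooth L (svf_smooth X) (svf_smooth Y)).
Definition phi_fun X : svf M := mk_svf (acm_phi_smooth acm (svf_smooth X)).
Definition xi_s : svf M := mk_svf (acm_xi_smooth acm).

Fact phi_fun_linear : linear phi_fun.
Proof. by move=> a X Y; apply: svf_ext => x; exact: linearP. Qed.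
HB.instance Definition _ :=
  GRing.isLinear.Build (sfun M) (svf M) (svf M) _ phi_fun phi_fun_linear.
Definition phi_s : {linear svf M -> svf M} := phi_fun.

Local Notation "'[ X , Y ]" := (torsion_free_bracket nabla_s X Y).

(** Torsion-freeness; it also derives smoothness of the Lie bracket from that of [nabla], as
    [jacobi] requires. *)
Lemma bracket_s X Y : svf_val '[X, Y] = lie_bracket X Y.
Proof.
apply/funext => x.
by rewrite -(conn_torsion_free L (svf_smooth X) (svf_smooth Y)).
Qed.

Lemma g_sE X Y x : g_s X Y x = @g x (X x) (Y x).
Proof. by []. Qed.

Lemma g_s_xi X x : g_s X xi_s x = eta x (X x).
Proof. exact: (acm_g_xi acm). Qed.

Lemma riemannian_calculus_s : riemannian_calculus act_s g_s nabla_s.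
Proof.
split.
- move=> a /(congr1 (@sfun_val _ _ _)) /funeqP a0; apply: sfun_ext => x.
  have : a x + a x = 0 by exact: a0.
  by move/eqP; rewrite -mulr2n mulrn_eq0 /= => /eqP.
- by move=> X a b; apply: sfun_ext => x; apply: vf_actB; exact: sfun_smooth.
- move=> X Y a; apply: sfun_ext => x.
  transitivity (vf_act (lie_bracket X Y) a x); first by rewrite -bracket_s.
  by apply: vf_act_bracket; [exact: svf_smooth..|exact: sfun_smooth].
- move=> X Y Z; apply: svf_ext => x.
  have sb (A B : svf M) : smooth_vf (lie_bracket A B).
    by rewrite -bracket_s; exact: svf_smooth.
  have := jacobi x (svf_smooth X) (svf_smooth Y) (svf_smooth Z)
    (sb _ _) (sb _ _) (sb _ _).
  by rewrite -!bracket_s.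
- by move=> a X Y Z; apply: sfun_ext => x; exact: (metric_linear rm).
- by move=> X Y; apply: sfun_ext => x; exact: (Defs.metric_sym rm).
- move=> X X0; apply: svf_ext => x.
  have gXX : @g x (X x) (X x) = 0.
    by have /(congr1 (@sfun_val _ _ _)) /funeqP/(_ x) := X0 X.
  have [//|nz] := eqVneq (X x) 0.
  by have := @metric_pos _ _ _ _ rm x (X x) nz; rewrite gXX ltxx.
- move=> a X Y Z; apply: svf_ext => x.
  have E := conn_addl L (smooth_vfZ (sfun_smooth a) (svf_smooth X))
    (svf_smooth Y) (svf_smooth Z) x.
  apply: etrans E _; congr (_ + _).
  exact: (conn_scalel L (sfun_smooth a) (svf_smooth X) (svf_smooth Z)).
- move=> X Y Z; apply: svf_ext => x; apply: (conn_addr L); exact: svf_smooth.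
- move=> X a Y; apply: svf_ext => x; apply: (conn_leibniz L).
  + exact: sfun_smooth.
  + exact: svf_smooth.
  + exact: svf_smooth.
- move=> X Y Z; apply: sfun_ext => x; apply: (conn_metric L); exact: svf_smooth.
Qed.

Lemma sasakian_calculus_s : sasakian_calculus act_s g_s nabla_s phi_s xi_s.
Proof.
have eta_s X : sfun_val (g_s X xi_s) = ap1 eta X.
  by apply/funext => x; exact: g_s_xi.
have contact X Y x : vf_act X (ap1 eta Y) x - vf_act Y (ap1 eta X) x
    - ap1 eta (lie_bracket X Y) x = @g x (X x) (phi x (Y x)) + @g x (X x) (phi x (Y x)).
  have := sasakian_contact S (svf_smooth X) (svf_smooth Y) x; rewrite /ext_d => H.
  (* Undoes the factor 1/2 of [ext_d], the abstract contact condition being doubled. *)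
  have half (a : R) : a = 2^-1 * a + 2^-1 * a by field.
  exact: etrans (half _) (congr1 (fun a => a + a) H).
split.
- move=> X; apply: svf_ext => x.
  by apply: etrans (acm_phi2 acm (X x : tangent x)) _; rewrite -g_s_xi.
- by apply: sfun_ext => x; rewrite g_s_xi; exact: (acm_eta_xi acm).
- by apply: svf_ext => x; exact: (acm_phi_xi acm).
- by move=> X Y; apply: sfun_ext => x; exact: (acm_g_skew acm).
- move=> X Y; apply: sfun_ext => x; apply: etrans (contact X Y x).
  by rewrite -bracket_s -!eta_s.
- move=> X Y; apply: svf_ext => x.
  have := sasakian_normal S (svf_smooth X) (svf_smooth Y) x.
  rewrite (sasakian_contact S (svf_smooth X) (svf_smooth Y)).
  rewrite mulr_natl mulr2n /nijenhuis.
  rewrite -(bracket_s X Y) -(bracket_s (phi_s X) (phi_s Y)).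
  by rewrite -(bracket_s (phi_s X) Y) -(bracket_s X (phi_s Y)).
Qed.

Let rc := riemannian_calculus_s.
Let sc := sasakian_calculus_s.
Local Notation curv_s := (curv nabla_s).

Lemma curvature_s X Y Z : curvature nabla X Y Z = curv_s X Y Z.
Proof. by apply/funext => x; rewrite curvE /curvature -bracket_s. Qed.

Lemma trace_field_s (F : vfield M -> vfield M) x A :
  (forall X, F X x = X x *m A) -> trace_field F x = \tr A.
Proof. by move=> FA; apply: trace_field_eq => X sX; exact: (FA (mk_svf sX)). Qed.

Lemma exists_svf x (v : 'rV[R]_m) : exists X, X x = v.
Proof. by have [X sX <-] := exists_smooth_vf x v; exists (mk_svf sX). Qed.

(** Tensoriality of the curvature in its first argument. Without a representing matrix [trace_field]
    would fall back on trace 0; with one, traces of sums can be computed. *)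
Lemma ricci_mx Y Z x : exists2 A, forall X, curv_s X Y Z x = X x *m A &
  ricci nabla Y Z x = \tr A.
Proof.
have [||A FA] := @tensorial_mx R m M (fun X : vfield M => curvature nabla X Y Z) x.
- move=> X X' sX sX'.
  have -> : (fun y => X y + X' y) = (mk_svf sX + mk_svf sX' : svf M) by [].
  rewrite curvature_s (curvDl rc).
  by rewrite -[X]/(svf_val (mk_svf sX)) -[X']/(svf_val (mk_svf sX')) !curvature_s.
- move=> f X sf sX.
  have -> : (fun y => f y *: X y) = (mk_sfun sf *: mk_svf sX : svf M) by [].
  rewrite curvature_s (curvZl rc).
  by rewrite -[X]/(svf_val (mk_svf sX)) !curvature_s.
have FA_s X : curvature nabla X Y Z x = X x *m A by apply: FA; exact: svf_smooth.
exists A; last exact: trace_field_s.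
by move=> X; rewrite -curvature_s.
Qed.

(** By [curv_xi] the trace is that of eta(X) times the identity, minus that of the rank-one map Y
    |-> eta(Y) X. *)
Lemma ricci_xi X x : ricci nabla X xi x = (m%:R - 1) * eta x (X x).
Proof.
rewrite -[xi]/(svf_val xi_s).
rewrite /ricci (@trace_field_s _ x ((eta x (X x))%:M - form_col (eta x) *m X x)).
  by rewrite linearB /= mxtrace_scalar trace_rank1 mulrBl mul1r mulr_natl.
move=> Y; rewrite curvature_s (curv_xi rc sc) mulmxBr mul_rank1 mul_mx_scalar.
by rewrite -!g_s_xi.
Qed.

Lemma ricci_horizontal E x : ricci_semisymmetric_along nabla xi ->
  g_s E xi_s = 0 -> ricci nabla E E x = (m%:R - 1) * @g x (E x) (E x).
Proof.
move=> semi etaE.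
have := semi _ _ _ (svf_smooth E) (svf_smooth E) (acm_xi_smooth acm) x.
rewrite -[xi]/(svf_val xi_s) !curvature_s (curv_xi_horizontal rc sc etaE) ricci_xi.
rewrite -g_s_xi (eta_curv_horizontal rc sc etaE) g_sE.
have [A AE ->] := ricci_mx E E x.
have -> : ricci nabla E (- E : svf M) x = \tr (- A).
  by apply: trace_field_s => X; rewrite curvature_s (curvNr rc) mulmxN -AE.
by rewrite linearN /= => /eqP; rewrite subr_eq0 => /eqP <-.
Qed.

Definition g_form x (w u : 'rV[R]_m) : R := @g x u w.

Fact g_form_scalar x w : scalar (g_form x w).
Proof. exact: metric_linear. Qed.
HB.instance Definition _ x w :=
  GRing.isLinear.Build R 'rV[R]_m R _ (g_form x w) (g_form_scalar x w).

Lemma star_ricci_horizontal E x : ricci_semisymmetric_along nabla xi ->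
  g_s E xi_s = 0 -> star_ricci nabla phi E E x = @g x (E x) (E x).
Proof.
move=> semi etaE; set F := phi_s E.
have etaF : g_s F xi_s = 0 by exact: (eta_phi rc sc).
have gFF : @g x (F x) (F x) = @g x (E x) (E x).
  by rewrite -!g_sE (g_phi_horizontal rc sc etaE).
have [A AE SE] := ricci_mx E E x; have [B BE SF] := ricci_mx F F x.
have tA := ricci_horizontal x semi etaE; have tB := ricci_horizontal x semi etaF.
rewrite SE in tA; rewrite SF gFF in tB.
set q := @g x (E x) (E x) in gFF tA tB *.
(* The matrix form of [phi_curv_phi]. Its trace is 2(m-1)q - 2mq + 4q = 2q, so the dimension cancels
   and the factor 1/2 leaves [q]. *)
rewrite /star_ricci (@trace_field_s _ x (A + B - (q + q)%:M
  + 2 *: (form_col (g_form x (E x)) *m E x) + 2 *: (form_col (g_form x (F x)) *m F x))).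
  have tE : \tr (form_col (g_form x (E x)) *m E x) = q by exact: trace_rank1.
  have tF : \tr (form_col (g_form x (F x)) *m F x) = q.
    by rewrite -gFF; exact: trace_rank1.
  rewrite !linearD linearN !linearZ /= mxtrace_scalar tA tB tE tF.
  by rewrite -mulr_natr; field.
move=> Z; rewrite -[ap11 phi E]/(svf_val F) curvature_s.
transitivity (phi_s (curv_s E F Z) x); first by [].
rewrite (phi_curv_phi rc sc Z etaE) -/F !mulmxDr mulmxN -AE -BE -!scalemxAr !mul_rank1.
rewrite mul_mx_scalar /g_form /= !scalerA !mulr_natl !mulr2n.
by [].
Qed.

Lemma lie_derivative_xi X Y x : lie_derivative xi g X Y x = 0.
Proof.
have /(congr1 (@sfun_val _ _ _)) /funeqP/(_ x) := killing rc sc X Y.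
by rewrite /lie_derivative -[xi]/(svf_val xi_s) -!bracket_s.
Qed.

Lemma star_ricci_xi x : star_ricci nabla phi xi xi x = 0.
Proof.
rewrite /star_ricci (@trace_field_s _ x 0) ?mxtrace0 ?mulr0 // => Z.
rewrite -[ap11 phi xi]/(svf_val (phi_s xi_s)) -[xi]/(svf_val xi_s) curvature_s.
have -> : curv_s xi_s (phi_s xi_s) Z = 0.
  have c0 X Y : curv_s 0 X Y = 0.
    by have := curvZl rc 0 0 X Y; rewrite !scale0r.
  by rewrite (sc_phi_xi sc) (curvC rc) c0 oppr0.
by rewrite mulmx0; exact: linear0.
Qed.

(** Any phi X is horizontal, so it is enough that phi is nonzero at [x]. Otherwise phi^2 = 0 there
    would make the identity equal to the rank-one map u |-> eta(u) xi, against m > 1. *)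
Lemma exists_horizontal x : (1 < m)%N ->
  exists2 E, g_s E xi_s = 0 & E x != 0.
Proof.
move=> m1; have [[v phiv]|phi0] := pselect (exists v, phi x v != 0).
  have [X Xv] := exists_svf x v; exists (phi_s X); first exact: (eta_phi rc sc).
  by rewrite /= /ap11 Xv.
have I1 : 1%:M = form_col (eta x) *m xi x.
  apply/row_matrixP => i; rewrite !rowE mulmx1 mul_rank1.
  have := acm_phi2 acm ('e_i : tangent x).
  have -> : phi x ('e_i) = 0.
    by apply/eqP; apply: contrapT => /negP H; apply: phi0; exists 'e_i.
  by rewrite linear0 => /eqP; rewrite eq_sym addrC subr_eq0 => /eqP ->.
have := mxrankM_maxr (form_col (eta x)) (xi x).
rewrite -I1 mxrank1 => /leq_trans/(_ (rank_leq_row _)).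
by rewrite leqNgt m1.
Qed.

End Geometry.

Theorem theorem4p1 (R : realType) (n : nat)
  (M : smooth_manifold R (2 * n + 1))
  (phi : tensor11 M) (xi : vfield M) (eta : covector_field M) (g : tensor02 M)
  (nabla : vfield M -> vfield M -> vfield M)
  (lambda mu : R) (p : M -> R) :
  (1 <= n)%N ->
  connected [set: M] ->
  sasakian phi xi eta g ->
  levi_civita g nabla ->
  ricci_semisymmetric_along nabla xi ->
  star_conformal_eta_ricci_soliton nabla phi xi eta g lambda mu p ->
  mu = 1 /\
  forall x : M, lambda = 2^-1 * (p x + 2 / (2 * n + 1)%:R) - 1.
Proof.
move=> n1 _ S L semi [_ sol].
have m1 : (1 < 2 * n + 1)%N by rewrite addn1 ltnS muln_gt0.
have acm := sasakian_acm S.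
(* The system is solved at each point, as [p] varies; for the constant [mu] one point suffices, and
   nonemptiness provides it. *)
suff H x : 2 * lambda - (p x + 2 / (2 * n + 1)%:R) = -2 /\ mu = 1.
  split; first by have [x _] := manifold_nonempty M; have [] := H x.
  by move=> x; have [E _] := H x; lra.
set q := _ - _.
have [E etaE E0] := exists_horizontal S L x m1.
have sE : smooth_vf E := svf_smooth E.
have sxi : smooth_vf xi := acm_xi_smooth acm.
have gE : 0 < @g x (E x) (E x) := @metric_pos _ _ _ _ (acm_metric acm) x (E x) E0.
have eE : ap1 eta E x = 0.
  by rewrite -[LHS]/(eta x (E x)) -(g_s_xi S) etaE.
(* At (E,E) the equation reduces to (2 + q) g(E,E) = 0, with g(E,E) > 0. *)
have qE : q = -2.
  have := sol _ _ sE sE x.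
  rewrite (lie_derivative_xi S L) (star_ricci_horizontal L x semi etaE) eE.
  rewrite mulr0 mulr0 addr0 add0r.
  rewrite -[ap02 g E E x]/(@g x (E x) (E x)) -/q -mulrDl => /eqP.
  by rewrite mulf_eq0 (gt_eqF gE) orbF addrC addr_eq0 => /eqP.
split=> //.
(* At (xi,xi) there remains q + 2 mu = 0. *)
have := sol _ _ sxi sxi x.
rewrite (lie_derivative_xi S L (xi_s S) (xi_s S)) (star_ricci_xi S L).
have -> : ap1 eta xi x = 1 by exact: (acm_eta_xi acm).
have -> : ap02 g xi xi x = 1.
  by rewrite /ap02 (acm_g_xi acm); exact: (acm_eta_xi acm).
rewrite -/q qE; lra.
Qed.
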